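(* Let $\Phi$ be an $(M_\Phi,\nu)$-self-concordant barrier for $\mathcal K$ and let $c\in(0,1)$, $b>0$. Further, suppose that for all $t\in[T]$, $\|g_t\|_{\nabla^{-2}\Phi(w_t)}\le b$, where $g_t\in\partial\ell_t(w_t)$ and $(w_t)$ are the iterates of BARONS with input parameters $(\eta,\varepsilon,\alpha,m_{\mathrm{Newton}})$ such that $$\eta=\sqrt{\frac{\nu\log(1/c)}{b^2T}},\quad \varepsilon=\sqrt{\frac{\nu}{T}},\quad\alpha=0.001,\quad m_{\mathrm{Newton}}=\Theta\Big(\log\frac1{\varepsilon M_\Phi}\Big).$$ For $T\ge1$ large enough such that $\eta\le\frac1{1000bM_\Phi}$ and $\varepsilon\le\frac1{20000M_\Phi}$, the regret of BARONS is bounded as $$\sum_{t=1}^T(\ell_t(w_t)-\ell_t(w))\lesssim b\sqrt{\nu T\log(1/c)}\qquad\text{for all } w\in\mathcal K_c,$$ where $\mathcal K_c=(1-c)\mathcal K\oplus\{c\,w^\star\}$ and $w^\star\in\arg\min_{w\in\mathcal K}\Phi(w)$. Further, the computational complexity of BARONS in this case is bounded by $$O\Big((\mathcal C^{\mathrm{grad}}_\varepsilon+d^2)\cdot T\cdot\log\frac{T}{\nu M_\Phi}+\mathcal C^{\mathrm{hess}}_\alpha\cdot M_\Phi\sqrt{T\nu\log(1/c)}\Big).$$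
   Context: **Online convex optimization.** $\mathcal K\subset\mathbb R^d$ is a convex compact set with non-empty interior $\operatorname{int}\mathcal K$. At each round $t=1,\dots,T$ the learner plays $w_t\in\mathcal K$ based on the history $\{(\ell_s,w_s)\}_{s<t}$; an adaptive adversary, knowing the history and $w_t$, picks a convex loss $\ell_t:\mathcal K\to\mathbb R$. **Notation.** For a positive definite matrix $A$, $\|x\|_A=\sqrt{x^\top Ax}$. $\nabla^{-2}\Phi=(\nabla^2\Phi)^{-1}$. $\oplus$ is the Minkowski sum. $f\lesssim g$ means $f\le Cg$ for a universal constant $C>0$; $O(\cdot)$ hides universal constants. $m=\Theta(x)$ means that $m$ is an integer between $c_1x$ and $c_2x$ for suitable universal constants $0<c_1\le c_2$. **Self-concordance.** A convex $C^3$ function $f:\operatorname{int}\mathcal K\to\mathbb R$ is self-concordant with constant $M_f\ge0$ if $f(x_k)\to+\infty$ whenever $x_k\to x\in\partial\mathcal K$, and $|\nabla^3f(x)[u,u,u]|\le2M_f\|u\|^3_{\nabla^2f(x)}$ for all $x\in\operatorname{int}\mathcal K$, $u\in\mathbb R^d$. It is an $(M_f,\nu)$-self-concordant barrier for $\mathcal K$ if moreover $\nabla f(w)^\top\nabla^{-2}f(w)\nabla f(w)\le\nu$ for all $w\in\operatorname{int}\mathcal K$. **Oracles.** The gradient oracle $\mathcal O^{\mathrm{grad}}_\varepsilon(\Phi)$, given $w\in\operatorname{int}\mathcal K$, returns a vector $\widehat\nabla_w$ with $\|\widehat\nabla_w-\nabla\Phi(w)\|_{\nabla^{-2}\Phi(w)}\le\varepsilon$;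 $\mathcal C^{\mathrm{grad}}_\varepsilon=\mathcal C^{\mathrm{grad}}_\varepsilon(\Phi)$ is the computational cost of one call. The Hessian oracle $\mathcal O^{\mathrm{hess}}_\alpha(\Phi)$, given $w\in\operatorname{int}\mathcal K$, returns a matrix $H$ and its inverse $H^{-1}$ with $(1-\alpha)\nabla^2\Phi(w)\preceq H\preceq(1+\alpha)\nabla^2\Phi(w)$ and $(1-\alpha)\nabla^{-2}\Phi(w)\preceq H^{-1}\preceq(1+\alpha)\nabla^{-2}\Phi(w)$; $\mathcal C^{\mathrm{hess}}_\alpha=\mathcal C^{\mathrm{hess}}_\alpha(\Phi)$ is the computational cost of one call. **Algorithm BARONS** (parameters $\eta,\varepsilon,\alpha>0$, $m_{\mathrm{Newton}}\ge1$; gradient and Hessian oracles for the self-concordant function $\Phi$ with constant $M_\Phi>0$; $w^\star\in\arg\min_{w\in\mathcal K}\Phi(w)$). Initialize $u_1=w_1=w^\star$, $H_1=\mathcal O^{\mathrm{hess}}_\alpha(w^\star)$, $s_0=0$. For $t=1,\dots,T$: 1. Play $w_t$, observe $g_t\in\partial\ell_t(w_t)$; set $s_t=s_{t-1}+\eta g_t$ and $w^1_{t+1}=w_t$. 2. For $m=1,\dots,m_{\mathrm{Newton}}-1$: set $\widehat\nabla^m_{t+1}=\mathcal O^{\mathrm{grad}}_\varepsilon(w^m_{t+1})$, $\widetilde\nabla^m_{t+1}=\widehat\nabla^m_{t+1}+s_t$, $w^{m+1}_{t+1}=w^m_{t+1}-H_t^{-1}\widetilde\nabla^m_{t+1}$.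 3. Set $w_{t+1}=w^{m_{\mathrm{Newton}}}_{t+1}$. 4. If $\|w_{t+1}-u_t\|_{H_t}\le1/(41M_\Phi)$, set $u_{t+1}=u_t$, $H_{t+1}=H_t$, $H_{t+1}^{-1}=H_t^{-1}$. Otherwise set $u_{t+1}=w_{t+1}$ and obtain $H_{t+1},H_{t+1}^{-1}$ from $\mathcal O^{\mathrm{hess}}_\alpha(u_{t+1})$.
   Formalization: The universal constants are uniform over c in (0,c_0] for each fixed c_0<1 and may depend on c_0 (they cannot be uniform as c tends to 1); the complexity bound additionally assumes nu <= T, since otherwise log(T/(nu M_Phi)) can be nonpositive for tiny M_Phi. *)

(* Defs.v *)
From HB Require Import structures.
From mathcomp Require Import all_boot all_order all_algebra.
From mathcomp Require Import all_classical all_reals all_analysis.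

Set Implicit Arguments.
Unset Strict Implicit.
Unset Printing Implicit Defensive.

Import Order.TTheory GRing.Theory Num.Theory.
Import numFieldNormedType.Exports.

Local Open Scope classical_set_scope.
Local Open Scope ring_scope.

Section Analysis.
Context {R : realType} {d : nat}.
Implicit Types (K U : set 'cV[R]_d) (f : 'cV[R]_d -> R) (w x : 'cV[R]_d).
Implicit Types A B : 'M[R]_d.

Definition dotv x w : R := (x^T *m w) ord0 ord0.

Definition mnorm A x : R := Num.sqrt (dotv x (A *m x)).

Definition psd A : Prop := A^T = A /\ forall x, 0 <= dotv x (A *m x).

Definition loewner_le A B : Prop := psd (B - A).

Definition basis_vec (i : 'I_d) : 'cV[R]_d := delta_mx i ord0.

Definition gradient f w : 'cV[R]_d := \col_i 'D_(basis_vec i) f w.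

Definition hessian f w : 'M[R]_d :=
  \matrix_(i, j) 'D_(basis_vec i) ('D_(basis_vec j) f) w.

(* The class C^k on an open set U, by recursion on directional derivatives. *)
Fixpoint class_C (k : nat) U f : Prop :=
  match k with
  | 0 => forall x, U x -> continuous_at x f
  | k'.+1 => (forall x, U x -> differentiable f x) /\
             forall v : 'cV[R]_d, class_C k' U ('D_v f)
  end.

Definition boundary K : set 'cV[R]_d := closure K `\` K°.

(* Functions on int K are represented by total functions whose values outside
   int K are irrelevant. *)
Definition self_concordant K (M : R) f : Prop :=
  [/\ 0 <= M,
      convex_function K° f,
      class_C 3 K° f,
      (forall (x_ : nat -> 'cV[R]_d) x, (forall k, K° (x_ k)) ->
         x_ @ \oo --> x -> boundary K x -> f (x_ k) @[k --> \oo] --> +oo)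
    & forall x u, K° x ->
        `|'D_u ('D_u ('D_u f)) x| <= 2 * M * mnorm (hessian f x) u ^+ 3].

Definition sc_barrier K (M nu : R) f : Prop :=
  self_concordant K M f /\
  forall w, K° w ->
    dotv (gradient f w) (invmx (hessian f w) *m gradient f w) <= nu.

(* A barrier is +oo on the boundary, so a minimizer over K is a minimizer over
   int K. *)
Definition argmin_barrier K f : set 'cV[R]_d :=
  [set w | K° w /\ forall x, K° x -> f w <= f x].

Definition subdifferential K f w : set 'cV[R]_d :=
  [set g | forall x, K x -> f w + dotv g (x - w) <= f x].

Definition minkowski_sum (A B : set 'cV[R]_d) : set 'cV[R]_d :=
  [set x + y | x in A & y in B].

Definition shrink K (c : R) w : set 'cV[R]_d :=
  minkowski_sum [set (1 - c) *: x | x in K] [set c *: w].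

(* Oracle answers are indexed by the serial number of the call, so that oracles
   may be stateful, randomized or adversarial. *)
Definition is_grad_oracle K f (eps : R) (O : nat -> 'cV[R]_d -> 'cV[R]_d) :=
  forall n w, K° w ->
    mnorm (invmx (hessian f w)) (O n w - gradient f w) <= eps.

Definition is_hess_oracle K f (alpha : R)
    (O : nat -> 'cV[R]_d -> 'M[R]_d * 'M[R]_d) :=
  forall n w, K° w ->
    let D2 := hessian f w in
    let: (H, Hinv) := O n w in
    [/\ H *m Hinv = 1%:M,
        loewner_le ((1 - alpha) *: D2) H,
        loewner_le H ((1 + alpha) *: D2),
        loewner_le ((1 - alpha) *: invmx D2) Hinv
      & loewner_le Hinv ((1 + alpha) *: invmx D2)].

End Analysis.

(* Programs over a real-arithmetic machine which records the oracle calls made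
   and the scalar operations (+, -, *, /, sqrt, <=) performed.  Assignments and
   the observation of the adversary's subgradient are free. *)
Record usage := Usage { grad_calls : nat; hess_calls : nat; flops : nat }.

Definition no_usage : usage := Usage 0 0 0.

Definition prog (A : Type) : Type := usage -> A * usage.

Definition ret {A : Type} (a : A) : prog A := fun r => (a, r).

Definition bind {A B : Type} (p : prog A) (q : A -> prog B) : prog B :=
  fun r => let: (a, r') := p r in q a r'.

Notation "'let*' x := p 'in' q" := (bind p (fun x => q))
  (at level 200, x name, p at level 100, q at level 200).

Fixpoint iterate {A : Type} (n : nat) (p : A -> prog A) (a : A) : prog A :=
  match n with
  | 0 => ret a
  | n'.+1 => let* a' := p a in iterate n' p a'
  end.

Definition pay {A : Type} (k : nat) (a : A) : prog A :=
  fun r => (a, Usage (grad_calls r) (hess_calls r) (k + flops r)).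

Definition call_grad {V W : Type} (O : nat -> V -> W) (w : V) : prog W :=
  fun r => (O (grad_calls r) w,
            Usage (grad_calls r).+1 (hess_calls r) (flops r)).

Definition call_hess {V W : Type} (O : nat -> V -> W) (w : V) : prog W :=
  fun r => (O (hess_calls r) w,
            Usage (grad_calls r) (hess_calls r).+1 (flops r)).

Section LinearAlgebraPrograms.
Context {R : realType} {d : nat}.

Definition vadd (x y : 'cV[R]_d) : prog 'cV[R]_d := pay d (x + y).
Definition vsub (x y : 'cV[R]_d) : prog 'cV[R]_d := pay d (x - y).
Definition vscale (a : R) (x : 'cV[R]_d) : prog 'cV[R]_d := pay d (a *: x).
Definition vmul (A : 'M[R]_d) (x : 'cV[R]_d) : prog 'cV[R]_d :=
  pay (2 * d * d) (A *m x).
Definition vnorm (A : 'M[R]_d) (x : 'cV[R]_d) : prog R :=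
  pay (2 * d * d + 2 * d + 1) (mnorm A x).

End LinearAlgebraPrograms.

Section Barons.
Context {R : realType} {d : nat}.

(* After round t the fields are s_t, w_{t+1}, u_{t+1}, H_{t+1}, H_{t+1}^-1. *)
Record barons_state := BaronsState {
  st_s : 'cV[R]_d;
  st_w : 'cV[R]_d;
  st_u : 'cV[R]_d;
  st_H : 'M[R]_d;
  st_Hinv : 'M[R]_d
}.

Variables (eta M : R) (m : nat) (wstar : 'cV[R]_d).
Variables (ograd : nat -> 'cV[R]_d -> 'cV[R]_d).
Variables (ohess : nat -> 'cV[R]_d -> 'M[R]_d * 'M[R]_d).
Variable g : nat -> 'cV[R]_d.

Definition barons_init : prog barons_state :=
  let* HH := call_hess ohess wstar in
  ret (BaronsState 0 wstar wstar HH.1 HH.2).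

Definition newton_step (s : 'cV[R]_d) (Hinv : 'M[R]_d) (w : 'cV[R]_d) :
    prog 'cV[R]_d :=
  let* hgrad := call_grad ograd w in
  let* tgrad := vadd hgrad s in
  let* dir := vmul Hinv tgrad in
  vsub w dir.

Definition barons_round (t : nat) (st : barons_state) : prog barons_state :=
  let* step := vscale eta (g t) in
  let* s := vadd (st_s st) step in
  let* w := iterate m.-1 (newton_step s (st_Hinv st)) (st_w st) in
  let* delta := vsub w (st_u st) in
  let* dist := vnorm (st_H st) delta in
  let* radius := pay 2 (1 / (41 * M)) in
  let* close := pay 1 (dist <= radius) in
  if close then ret (BaronsState s w (st_u st) (st_H st) (st_Hinv st))
  else let* HH := call_hess ohess w in
       ret (BaronsState s w w HH.1 HH.2).

Fixpoint barons (t : nat) : prog barons_state :=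
  match t with
  | 0 => barons_init
  | t'.+1 => let* st := barons t' in barons_round t'.+1 st
  end.

(* w_t, for t >= 1 *)
Definition barons_play (t : nat) : 'cV[R]_d :=
  st_w (barons t.-1 no_usage).1.

Definition barons_cost (Cgrad Chess : R) (T : nat) : R :=
  let r := (barons T no_usage).2 in
  Cgrad * (grad_calls r)%:R + Chess * (hess_calls r)%:R + (flops r)%:R.

End Barons.

(* Main.v *)
(* Let [y_t] minimize [Phi + s_(t-1)], where [s_t] is the sum of the [eta g_i],
   [i <= t]. The "be the leader" inequality
     eta * sum g_t . (y_(t+1) - w) <= Phi w - Phi w* <= nu ln (1/c)
   reduces the regret to the distances from [w_t] to [y_(t+1)] in the local norm
   at [w_t]. The gradient of [Phi + s_t] at [w_t] has dual norm at most
   [4 eps + eta b], so self-concordance makes these distances of the same order.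
   The invariant behind that bound is kept by the Newton steps: inside the ball
   around [u_t] the Hessian stays within a factor of [H_t], so each step contracts
   the distance to [y_(t+1)] by [1/3] up to an oracle error of order [eps].
   As [w_t] moves by [O(eps + eta b)] per round, [u_t] changes at most
   [O(M T (eps + eta b))] times; the first Hessian call is absorbed since
   [M^2 nu >= 1/4].

   Stability of the Hessian is obtained from self-concordance along lines only:
   the Bregman divergences of [f] are quadratic up to a cubic error, and
     D(x,y+v) + D(x,y-v) - 2 D(x,y) = D(y,y+v) + D(y,y-v)
   compares the Hessians at [x] and [y]. No mixed third derivatives occur. *)
Require Import Defs.
From HB Require Import structures.
From mathcomp Require Import all_boot all_order all_algebra.
From mathcomp Require Import all_classical all_reals all_analysis.
From mathcomp Require Import zify ring lra.

Set Implicit Arguments.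
Unset Strict Implicit.
Unset Printing Implicit Defensive.

Import Order.TTheory GRing.Theory Num.Theory.
Import numFieldNormedType.Exports.

Local Open Scope classical_set_scope.
Local Open Scope ring_scope.

(** * Quadratic forms *)

Section QuadraticForms.
Context {R : realType} {d : nat}.
Implicit Types (x y z g : 'cV[R]_d) (A B H : 'M[R]_d) (a : R).

Lemma dotvE x y : dotv x y = \sum_i x i ord0 * y i ord0.
Proof. by rewrite /dotv mxE; apply: eq_bigr => i _; rewrite mxE. Qed.

Lemma dotvC x y : dotv x y = dotv y x.
Proof. by rewrite !dotvE; apply: eq_bigr => i _; rewrite mulrC. Qed.

Lemma dotvDr x y z : dotv x (y + z) = dotv x y + dotv x z.
Proof. by rewrite /dotv mulmxDr mxE. Qed.

Lemma dotvZr x a y : dotv x (a *: y) = a * dotv x y.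
Proof. by rewrite /dotv -scalemxAr mxE. Qed.

Lemma dotvNr x y : dotv x (- y) = - dotv x y.
Proof. by rewrite -scaleN1r dotvZr mulN1r. Qed.

Lemma dotvBr x y z : dotv x (y - z) = dotv x y - dotv x z.
Proof. by rewrite dotvDr dotvNr. Qed.

Lemma dotv0r x : dotv x 0 = 0.
Proof. by rewrite -(scale0r 0) dotvZr mul0r. Qed.

Lemma dotvDl x y z : dotv (x + y) z = dotv x z + dotv y z.
Proof. by rewrite dotvC dotvDr !(dotvC z). Qed.

Lemma dotvZl a x y : dotv (a *: x) y = a * dotv x y.
Proof. by rewrite dotvC dotvZr dotvC. Qed.

Lemma dotvNl x y : dotv (- x) y = - dotv x y.
Proof. by rewrite dotvC dotvNr dotvC. Qed.

Lemma dotvBl x y z : dotv (x - y) z = dotv x z - dotv y z.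
Proof. by rewrite dotvDl dotvNl. Qed.

Lemma dotv_sumr x (I : Type) (r : seq I) (P : pred I) (F : I -> 'cV[R]_d) :
  dotv x (\sum_(i <- r | P i) F i) = \sum_(i <- r | P i) dotv x (F i).
Proof. by elim/big_rec2: _ => [|i u v _ <-]; rewrite ?dotv0r ?dotvDr. Qed.

Lemma dotvv_eq0 x : dotv x x = 0 -> x = 0.
Proof.
rewrite dotvE => /eqP; rewrite psumr_eq0 => [/allP x0|i _]; last first.
  by rewrite -expr2 sqr_ge0.
apply/colP => i; rewrite mxE; apply/eqP.
by have := x0 i (mem_index_enum _); rewrite mulf_eq0 orbb.
Qed.

Lemma dotv_mulmx_sym A x y : A^T = A -> dotv x (A *m y) = dotv y (A *m x).
Proof.
move=> sA; rewrite (dotvC y) /dotv trmx_mul sA mulmxA.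
by [].
Qed.

Lemma quadD A x y : A^T = A ->
  dotv (x + y) (A *m (x + y)) =
    dotv x (A *m x) + 2 * dotv x (A *m y) + dotv y (A *m y).
Proof.
move=> sA; rewrite mulmxDr !dotvDr !dotvDl (dotv_mulmx_sym y x sA); ring.
Qed.

Lemma quadZ A a x : dotv (a *: x) (A *m (a *: x)) = a ^+ 2 * dotv x (A *m x).
Proof. by rewrite -scalemxAr dotvZr dotvZl mulrA -expr2. Qed.

(** The form at [q x - b y] equals [q (p q - b^2)], which settles [q > 0]; for [q = 0],
    nonnegativity on a whole line forces [b = 0]. *)
Lemma psd_cauchy_schwarz A x y : psd A ->
  dotv x (A *m y) ^+ 2 <= dotv x (A *m x) * dotv y (A *m y).
Proof.
move=> [sA pA].
set b := dotv x (A *m y); set p := dotv x _; set q := dotv y _.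
have key s t : 0 <= s ^+ 2 * p + 2 * s * t * b + t ^+ 2 * q.
  have := pA (s *: x + t *: y); rewrite quadD// !quadZ -scalemxAr.
  by rewrite dotvZl dotvZr -/b -/p -/q !mulrA -[2 * _ * _ * _]mulrA.
have q0 : 0 <= q by exact: pA.
move: q0; rewrite le_eqVlt => /predU1P[q0|q0].
  have [->|b0] := eqVneq b 0; first by rewrite -q0 mulr0 expr0n.
  (* With this multiple of [y] added to [x] the form would take the value [-1]. *)
  have := key 1 (- (p + 1) / (2 * b)); rewrite -q0.
  have -> : 2 * 1 * (- (p + 1) / (2 * b)) * b = - (p + 1) by field.
  by rewrite expr1n mul1r mulr0; lra.
have := key q (- b).
have -> : q ^+ 2 * p + 2 * q * - b * b + (- b) ^+ 2 * q = q * (p * q - b ^+ 2).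
  by ring.
by rewrite pmulr_rge0// subr_ge0.
Qed.

Definition pdef A := A^T = A /\ forall x, x != 0 -> 0 < dotv x (A *m x).

Lemma pdef_psd A : pdef A -> psd A.
Proof.
move=> [sA pA]; split=> // x.
have [->|/pA/ltW//] := eqVneq x 0.
by rewrite mulmx0 dotv0r.
Qed.

(** By Cauchy-Schwarz for the semidefinite form, [x^T A x = 0] implies [A x = 0]. *)
Lemma psd_unit_pdef A : psd A -> A \in unitmx -> pdef A.
Proof.
move=> pA uA; split=> [|x x0]; first by case: pA.
rewrite lt_neqAle (pA.2 x) andbT eq_sym; apply: contra x0 => /eqP x0.
have /dotvv_eq0 Ax : dotv (A *m x) (A *m x) = 0.
  apply/eqP; rewrite -sqrf_eq0 eq_le sqr_ge0 andbT.
  by rewrite (le_trans (psd_cauchy_schwarz _ _ pA))// x0 mulr0.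
by rewrite -(mulKmx uA x) Ax mulmx0.
Qed.

Lemma pdef_unitmx A : pdef A -> A \in unitmx.
Proof.
move=> [sA pA]; rewrite -row_free_unit -kermx_eq0; apply/rowV0P => v.
move=> /sub_kermxP vA; apply/eqP/contraT => v0.
have : v^T != 0 by rewrite -(trmx0 R) (inj_eq (can_inj (@trmxK _ _ _))).
move=> /pA; rewrite /dotv.
rewrite trmxK mulmxA vA mul0mx mxE.
by rewrite ltxx.
Qed.

Lemma mnorm_ge0 A x : 0 <= mnorm A x.
Proof. exact: sqrtr_ge0. Qed.
Local Hint Resolve mnorm_ge0 : core.

Lemma sqr_mnorm A x : psd A -> mnorm A x ^+ 2 = dotv x (A *m x).
Proof. by move=> [_ pA]; rewrite sqr_sqrtr. Qed.

Lemma mnormZ A a x : mnorm A (a *: x) = `|a| * mnorm A x.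
Proof. by rewrite /mnorm quadZ sqrtrM ?sqr_ge0// sqrtr_sqr. Qed.

Lemma mnormN A x : mnorm A (- x) = mnorm A x.
Proof. by rewrite -scaleN1r mnormZ normrN1 mul1r. Qed.

Lemma mnorm0 A : mnorm A 0 = 0.
Proof. by rewrite -(scale0r 0) mnormZ normr0 mul0r. Qed.

Lemma mnormBC A x y : mnorm A (x - y) = mnorm A (y - x).
Proof. by rewrite -mnormN opprB. Qed.

Lemma mnorm_cauchy_schwarz A x y : psd A ->
  `|dotv x (A *m y)| <= mnorm A x * mnorm A y.
Proof.
move=> pA; rewrite -ler_sqr ?nnegrE ?mulr_ge0// exprMn !sqr_mnorm//.
by rewrite real_normK ?num_real ?psd_cauchy_schwarz.
Qed.

Lemma ler_mnormD A x y : psd A -> mnorm A (x + y) <= mnorm A x + mnorm A y.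
Proof.
move=> pA; rewrite -ler_sqr ?nnegrE ?addr_ge0// sqr_mnorm// quadD ?pA.1//.
rewrite sqrrD !sqr_mnorm//.
have := le_trans (ler_norm _) (mnorm_cauchy_schwarz x y pA); lra.
Qed.

Lemma mnorm_gt0 A x : pdef A -> x != 0 -> 0 < mnorm A x.
Proof. by move=> [_ pA] /pA; rewrite /mnorm sqrtr_gt0. Qed.

(** The dual norm of [g] is the [A]-norm of [A^-1 g], and [g = A (A^-1 g)]. *)
Lemma mnorm_dual A g x : pdef A ->
  `|dotv g x| <= mnorm (invmx A) g * mnorm A x.
Proof.
move=> pA; have uA := pdef_unitmx pA.
rewrite dotvC -{1}(mulKVmx uA g).
have -> : mnorm (invmx A) g = mnorm A (invmx A *m g).
  by rewrite /mnorm (mulKVmx uA) dotvC.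
by rewrite mulrC mnorm_cauchy_schwarz//; exact: pdef_psd.
Qed.

Lemma ler_mnorm (k : R) A B x : 0 <= k ->
  dotv x (A *m x) <= k ^+ 2 * dotv x (B *m x) ->
  mnorm A x <= k * mnorm B x.
Proof.
move=> k0 AB; rewrite /mnorm -[k](ger0_norm k0) -sqrtr_sqr -sqrtrM ?sqr_ge0//.
exact: ler_wsqrtr.
Qed.

Lemma loewner_leP A B : loewner_le A B ->
  forall x, dotv x (A *m x) <= dotv x (B *m x).
Proof.
by move=> [_ pAB] x; have := pAB x; rewrite mulmxBl dotvBr subr_ge0.
Qed.

(* Polarization and the parallelogram law. *)
Lemma mnorm_bilin_le (k : R) A H x y : 0 <= k -> A^T = A -> pdef H ->
  (forall z, `|dotv z (A *m z)| <= k * dotv z (H *m z)) ->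
  `|dotv x (A *m y)| <= k * (mnorm H x * mnorm H y).
Proof.
move=> k0 sA pH AH.
have [->|x0] := eqVneq x 0; first by rewrite dotvC dotv0r normr0 !mulr_ge0.
have [->|y0] := eqVneq y 0.
  by rewrite mulmx0 dotv0r normr0 !mulr_ge0.
have nx := mnorm_gt0 pH x0; have ny := mnorm_gt0 pH y0.
have sH := pH.1; have psdH := pdef_psd pH.
set p := mnorm H x in nx *; set q := mnorm H y in ny *.
(* Rescaling gives both vectors the [H]-norm [p q]; otherwise the parallelogram law would yield a
   sum of squares instead of a product. *)
pose u := q *: x; pose v := p *: y.
have Hu : dotv u (H *m u) = (p * q) ^+ 2.
  by rewrite quadZ -sqr_mnorm// -exprMn mulrC.
have Hv : dotv v (H *m v) = (p * q) ^+ 2.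
  by rewrite quadZ -sqr_mnorm// -exprMn.
have Dp := AH (u + v); have Dm := AH (u - v).
rewrite (quadD u v sA) (quadD u v sH) in Dp.
rewrite (quadD u (- v) sA) (quadD u (- v) sH) in Dm.
rewrite !mulmxN !dotvNr !dotvNl !opprK in Dm.
have Auv : dotv u (A *m v) = (p * q) * dotv x (A *m y).
  by rewrite -scalemxAr dotvZl dotvZr; ring.
have : `|dotv u (A *m v)| <= k * (p * q) ^+ 2.
  move: Dp Dm; rewrite Hu Hv => /ler_normlP[Dp1 Dp2] /ler_normlP[Dm1 Dm2].
  by apply/ler_normlP; split; lra.
have pq : 0 < p * q by rewrite mulr_gt0.
by rewrite Auv normrM (gtr0_norm pq) expr2 mulrCA ler_pM2l.
Qed.

End QuadraticForms.

(** * Derivatives along lines *)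

Section RealFunctions.
Context {R : realType}.
Implicit Types (f g : R -> R) (a b t : R).

Lemma is_derive_within_continuous f (f' : R -> R) a b :
  (forall t, a <= t <= b -> is_derive t 1 f (f' t)) ->
  {within `[a, b], continuous f}.
Proof.
move=> df; apply: derivable_within_continuous => t; rewrite in_itv/= => tab.
by have [] := df t tab.
Qed.

Lemma ex_mean_value f (f' : R -> R) a b : a <= b ->
  (forall t, a <= t <= b -> is_derive t 1 f (f' t)) ->
  exists2 c, a <= c <= b & f b - f a = f' c * (b - a).
Proof.
move=> ab df.
have df' t : t \in `]a, b[ -> is_derive t 1 f (f' t).
  by rewrite in_itv/= => /andP[ta tb]; apply: df; rewrite !ltW.
have [c cab e] := MVT_segment ab df' (is_derive_within_continuous df).
by exists c => //; rewrite in_itv/= in cab.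
Qed.

(** The mean value theorem for [g - f]. Comparing increments in this way takes the place of
    integration in the later estimates. *)
Lemma ler_increment f g (f' g' : R -> R) a b : a <= b ->
  (forall t, a <= t <= b -> is_derive t 1 f (f' t)) ->
  (forall t, a <= t <= b -> is_derive t 1 g (g' t)) ->
  (forall t, a <= t <= b -> f' t <= g' t) ->
  f b - f a <= g b - g a.
Proof.
move=> ab df dg fg.
have dfg t : a <= t <= b -> is_derive t 1 (g - f) (g' t - f' t).
  by move=> tab; have := df t tab; have := dg t tab => ? ?; apply: is_deriveB.
have [c cab e] := ex_mean_value ab dfg.
move: e; rewrite -[(g - f) b]/(g b - f b) -[(g - f) a]/(g a - f a) => e.
have : 0 <= (g' c - f' c) * (b - a) by rewrite mulr_ge0 ?subr_ge0 ?fg.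
by rewrite -e; lra.
Qed.

Lemma is_derive_affine a (k : R) t : is_derive t 1 (fun s => a + s * k) k.
Proof.
have := is_deriveD (is_derive_cst a t 1) (is_deriveZ k (is_derive_id t 1)).
rewrite add0r /GRing.scale/= mulr1; congr is_derive; apply/funext => s.
by rewrite mulrC.
Qed.

Lemma is_derive_sqrtV f t (f' : R) : 0 < f t -> is_derive t 1 f f' ->
  is_derive t 1 (fun s => (Num.sqrt (f s))^-1) (- f' / (2 * Num.sqrt (f t) ^+ 3)).
Proof.
move=> ft df.
have sf : 0 < Num.sqrt (f t) by rewrite sqrtr_gt0.
have ds : is_derive t 1 (Num.sqrt \o f) ((2 * Num.sqrt (f t))^-1 *: f').
  by apply: is_derive1_comp; exact: is_derive1_sqrt.
have nz : (Num.sqrt \o f) t != 0 by rewrite /= gt_eqF.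
have := is_deriveV nz ds.
set e := (X in is_derive _ _ _ X) => de; suff <- : e = - f' / (2 * Num.sqrt (f t) ^+ 3) by [].
rewrite /e /= /GRing.scale/=.
by field; rewrite gt_eqF.
Qed.

(* Differentiating [1 / sqrt p] linearizes the inequality [|p'| <= 2 M p^(3/2)]. *)
Lemma self_concordant_growth (p p' : R -> R) (M a b : R) : a <= b ->
  (forall t, a <= t <= b -> is_derive t 1 p (p' t)) ->
  (forall t, a <= t <= b -> 0 < p t) ->
  (forall t, a <= t <= b -> `|p' t| <= 2 * M * Num.sqrt (p t) ^+ 3) ->
  `|(Num.sqrt (p b))^-1 - (Num.sqrt (p a))^-1| <= M * (b - a).
Proof.
move=> ab dp p0 pM.
have dq t : a <= t <= b ->
    is_derive t 1 (fun s => (Num.sqrt (p s))^-1)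
      (- p' t / (2 * Num.sqrt (p t) ^+ 3)).
  by move=> tab; apply: is_derive_sqrtV; [exact: p0 | exact: dp].
have qM t : a <= t <= b -> `|- p' t / (2 * Num.sqrt (p t) ^+ 3)| <= M.
  move=> tab; have s0 : 0 < 2 * Num.sqrt (p t) ^+ 3.
    by rewrite mulr_gt0// exprn_gt0// sqrtr_gt0 p0.
  rewrite normrM normrN normfV (gtr0_norm s0) ler_pdivrMr//.
  by have := pM t tab; lra.
have dl (k : R) t : a <= t <= b -> is_derive t 1 (fun s => k * s) k.
  move=> _; have := is_derive_affine 0 k t; congr is_derive; apply/funext => s.
  by rewrite add0r mulrC.
rewrite ler_norml; apply/andP; split.
  have := ler_increment ab (dl (- M)) dq.
  rewrite -mulrBr mulNr; apply => t /qM.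
  by rewrite ler_norml => /andP[].
have := ler_increment ab dq (dl M).
rewrite -mulrBr; apply => t /qM.
by rewrite ler_norml => /andP[].
Qed.

End RealFunctions.

Section LineRestriction.
Context {R : realType} {d : nat}.
Implicit Types (f : 'cV[R]_d -> R) (x h u v : 'cV[R]_d) (U : set 'cV[R]_d).

(** The difference quotients of the two sides coincide, so a derivative in the single direction [h]
    suffices. *)
Lemma is_derive_line f x h (t : R) : derivable f (x + t *: h) h ->
  is_derive t 1 (fun s => f (x + s *: h)) ('D_h f (x + t *: h)).
Proof.
move=> df.
have e : (fun s : R => s^-1 *: (((fun s => f (x + s *: h)) \o shift t) (s *: 1)
    - f (x + t *: h))) =
  (fun s : R => s^-1 *: ((f \o shift (x + t *: h)) (s *: h) - f (x + t *: h))).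
  apply/funext => s /=; congr (_ *: (f _ - _)).
  by rewrite scalerDl [s *: 1]mulr1 addrCA.
by split; rewrite /derivable /derive e.
Qed.

Lemma basis_vec_sum v : v = \sum_i v i ord0 *: basis_vec i.
Proof.
rewrite {1}(matrix_sum_delta v); apply: eq_bigr => i _.
by rewrite big_ord1.
Qed.

Lemma derive_gradient f x v : differentiable f x ->
  'D_v f x = dotv (gradient f x) v.
Proof.
move=> df; rewrite deriveE// {1}(basis_vec_sum v) linear_sum dotvE.
apply: eq_bigr => i _.
by rewrite linearZ/= -deriveE// !mxE mulrC.
Qed.

(** Near [x] the function ['D_v f] is the combination of partial derivatives with the coordinates of
    [v] as coefficients, and is differentiated term by term. The order of differentiation matches
    [hessian], so derivatives are never interchanged. *)
Lemma derive2_hessian U f x u v : open U -> class_C 2 U f -> U x ->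
  'D_u ('D_v f) x = dotv u (hessian f x *m v).
Proof.
move=> oU [df d2f] Ux.
have nU : \forall y \near x, U y by exact: open_nbhs_nbhs.
have e : \near x, 'D_v f x = (\sum_i (v i ord0 *: 'D_(basis_vec i) f)) x.
  near=> y; have Uy : U y by near: y.
  rewrite derive_gradient; last exact: df.
  rewrite dotvE fct_sumE; apply: eq_bigr => i _.
  by rewrite mxE mulrC.
have dd (w : 'cV[R]_d) : derivable ('D_w f) x u.
  by apply: diff_derivable; exact: (d2f w).1.
rewrite (near_eq_derive _ e) derive_sum; last first.
  by move=> i; apply: derivableZ.
have -> : hessian f x *m v =
    \sum_j v j ord0 *: (\col_i 'D_(basis_vec i) ('D_(basis_vec j) f) x).
  apply/colP => i; rewrite mxE summxE; apply: eq_bigr => j _.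
  by rewrite !mxE mulrC.
rewrite dotv_sumr; apply: eq_bigr => j _.
rewrite deriveZ// dotvZr; congr (_ * _).
rewrite derive_gradient; last exact: (d2f _).1.
by rewrite dotvC; congr dotv; apply/colP => i; rewrite !mxE.
Unshelve. all: by end_near. Qed.

End LineRestriction.

(** * Convex bodies and barriers *)

Section ConvexBodies.
Context {R : realType} {d : nat}.
Implicit Types (K : set 'cV[R]_d) (x y h v s p : 'cV[R]_d) (t : R).

Lemma convex_setP K x y t : convex_set K -> K x -> K y -> 0 <= t <= 1 ->
  K (x + t *: (y - x)).
Proof.
move=> cK Kx Ky /andP[t0 t1].
have := cK y x (Itv01 t0 t1); rewrite !inE => /(_ Ky Kx).
congr K; rewrite /conv/= scalerBr scalerBl scale1r.
by rewrite addrCA.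
Qed.

Lemma cvg_line x h t : (fun s : R => x + s *: h) @ t --> x + t *: h.
Proof.
by apply: cvgD; [exact: cvg_cst|apply: cvgZr_tmp; exact: cvg_id].
Qed.

Lemma near_line K x h t : K° (x + t *: h) ->
  \forall r \near t, K° (x + r *: h).
Proof.
move=> Kt; have nK := open_nbhs_nbhs (conj (@open_interior _ K) Kt).
by have /(_ _ nK) := @cvg_line x h t.
Qed.

Lemma interior_line_nbhs K x h : K° x ->
  exists2 e : R, 0 < e & forall t, `|t| < e -> K° (x + t *: h).
Proof.
move=> Kx; have K0 : K° (x + 0 *: h) by rewrite scale0r addr0.
have /nbhs_ballP[e e0 H] := near_line K0.
exists e => [|t te]; first exact: e0.
by apply: H; rewrite /ball/= sub0r normrN.
Qed.

(** The homothety [g] with centre [y] takes the point to [x]. Every [z] near the point has [g z] in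
    [K] and lies between [g z] and [y]. *)
Lemma interior_segment K x y t : convex_set K -> K° x -> K y -> 0 <= t < 1 ->
  K° (x + t *: (y - x)).
Proof.
move=> cK Kx Ky /andP[t0 t1].
have u1 : 0 < 1 - t by rewrite subr_gt0.
pose g (z : 'cV[R]_d) := (1 - t)^-1 *: (z - t *: y).
have gp : g (x + t *: (y - x)) = x.
  rewrite /g (_ : _ - _ = (1 - t) *: x).
    by rewrite scalerA mulVf ?lt0r_neq0// scale1r.
  by rewrite scalerBr scalerBl scale1r addrCA [LHS]addrC addKr.
have cg : {for x + t *: (y - x), continuous g}.
  exact: (cvgZ (cvg_cst _) (cvgB cvg_id (cvg_cst _))).
have nK : nbhs (g (x + t *: (y - x))) K by rewrite gp.
apply: (@filterS _ _ _ (g @^-1` K) K _ (cg _ nK)) => z /= Kgz.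
have := convex_setP cK Kgz Ky (t := t); rewrite t0 ltW// => /(_ isT).
congr K.
rewrite scalerBr addrA addrAC -{1}[g z]scale1r -scalerBl /g.
by rewrite scalerA mulfV ?lt0r_neq0// scale1r subrK.
Qed.

Lemma interior_segmentW K x y t : convex_set K -> K° x -> K° y -> 0 <= t <= 1 ->
  K° (x + t *: (y - x)).
Proof.
move=> cK Kx Ky /andP[t0]; rewrite le_eqVlt => /predU1P[->|t1].
  by rewrite scale1r addrC subrK.
by apply: interior_segment => //; [exact: interior_subset|rewrite t0].
Qed.

Lemma differentiable_dotv s x : differentiable (dotv s) x.
Proof.
have -> : dotv s = (\sum_i (s i ord0 *: (fun y : 'cV[R]_d => y i ord0))).
  by apply/funext => y; rewrite dotvE fct_sumE; apply: eq_bigr.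
by apply: differentiable_sum => i; apply: differentiableZ; exact: differentiable_coord.
Qed.

Lemma dotv_continuous s : continuous (dotv s).
Proof. by move=> x; apply: differentiable_continuous; exact: differentiable_dotv. Qed.

Definition blows_up K (f : 'cV[R]_d -> R) :=
  forall (x_ : nat -> 'cV[R]_d) x, (forall k, K° (x_ k)) ->
    x_ @ \oo --> x -> boundary K x -> f (x_ k) @[k --> \oo] --> +oo.

(** The time [t] is the supremum of the times in [[0, 1]] at which the ray is in the interior.
    Openness gives the last clause: a ray still inside at time [t] forces [t = 1]. *)
Lemma ray_exit_time K x h : convex_set K -> K° x ->
  exists2 t : R, 0 < t <= 1 &
    (forall s : R, 0 <= s < t -> K° (x + s *: h)) /\
    (K° (x + t *: h) -> K° (x + h)).
Proof.
move=> cK Kx.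
pose S := [set s : R | 0 <= s <= 1 /\ K° (x + s *: h)].
have S0 : S 0 by split; rewrite ?lexx ?ler01// scale0r addr0.
have S1 : ubound S 1 by move=> s [/andP[]].
have bS : has_sup S by split; [exists 0|exists 1].
pose t := sup S.
have [e e0 He] := interior_line_nbhs h Kx.
have t1 : t <= 1 := ge_sup bS.1 S1.
have t0 : 0 < t.
  pose s := Num.min (e / 2) 1.
  have s0 : 0 < s by rewrite lt_min ltr01 divr_gt0.
  suff Ss : S s by exact: lt_le_trans s0 (ub_le_sup bS.2 Ss).
  split; first by rewrite (ltW s0)/= ge_min lexx orbT.
  by apply: He; rewrite gtr0_norm// gt_min ltr_pdivrMr// ltr_pMr// ltr1n.
exists t; first by rewrite t0.
split=> [s /andP[s0 st]|Kt].
  have ts : 0 < t - s by rewrite subr_gt0.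
  have [u [/andP[u0 u1] Ku]] := sup_adherent ts bS; rewrite -/t subKr => su'.
  have u00 : 0 < u by exact: le_lt_trans su'.
  have su01 : 0 <= s / u <= 1.
    by rewrite divr_ge0//= ler_pdivrMr// mul1r ltW.
  have := interior_segmentW cK Kx Ku su01.
  by rewrite addrAC subrr add0r scalerA divfK ?gt_eqF.
have [e' e'0 He'] := interior_line_nbhs h Kt.
have [t1'|t1'] := ltP t 1; last first.
  have t11 : t = 1 by apply/le_anti; rewrite t1.
  by move: Kt; rewrite t11 scale1r.
pose s := t + Num.min (e' / 2) (1 - t).
have m0 : 0 < Num.min (e' / 2) (1 - t) by rewrite lt_min subr_gt0 t1' divr_gt0.
have ts : t < s by rewrite ltrDl.
suff Ss : S s.
  have ss := ub_le_sup bS.2 Ss.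
  by exfalso; have := lt_le_trans ts ss; rewrite ltxx.
split; first by rewrite /s (addr_ge0 (ltW t0) (ltW m0))/= -lerBrDl ge_min lexx orbT.
rewrite /s scalerDl addrA; apply: He'.
by rewrite gtr0_norm// gt_min ltr_pdivrMr// ltr_pMr// ltr1n.
Qed.

(** The exit point is a boundary point, approached from inside at the times [t (1 - 1/(k+1))]. *)
Lemma ray_blows_up K f x h : convex_set K -> blows_up K f -> K° x ->
  ~ K° (x + h) ->
  exists2 t : R, 0 < t <= 1 &
    (forall s : R, 0 <= s < t -> K° (x + s *: h)) /\
    (forall B : R, exists2 s : R, 0 <= s < t & B < f (x + s *: h)).
Proof.
move=> cK bf Kx.
have [t /andP[t0 t1] [inS Kth]] := ray_exit_time h cK Kx.
move=> /(contra_not Kth) nKt.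
exists t; first by rewrite t0 t1.
split=> [|B]; first exact: inS.
pose s_ k : R := t * (1 - k.+1%:R^-1).
have s_lt k : 0 <= s_ k < t.
  have k1 : 0 <= 1 - (k.+1%:R : R)^-1 by rewrite subr_ge0 invf_le1// ler1n.
  by rewrite /s_ (mulr_ge0 (ltW t0) k1) /= gtr_pMr// ltrBlDr ltrDl invr_gt0.
have cs : s_ @ \oo --> t.
  rewrite -[X in _ --> X]mulr1 -[X in _ * X]subr0; apply: cvgMl_tmp.
  by apply: cvgB; [exact: cvg_cst|exact: cvg_harmonic].
have cx : (fun k => x + s_ k *: h) @ \oo --> x + t *: h.
  by apply: cvgD; [exact: cvg_cst|apply: cvgZr_tmp].
have bx : boundary K (x + t *: h).
  split=> //; apply: (closed_cvg _ _ _ _ cx); first exact: closed_closure.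
  by near=> k; apply: subset_closure; apply: interior_subset; exact: inS.
have := bf _ _ (fun k => inS _ (s_lt k)) cx bx.
move=> /cvgryPgt/(_ B)[N _ /(_ N (leqnn N))/= HB].
by exists (s_ N).
Unshelve. all: by end_near. Qed.

Lemma barrier_tilt_min K f s x0 : compact K -> blows_up K f ->
  (forall x, K° x -> differentiable f x) -> K° x0 ->
  exists2 y, K° y & forall x, K° x -> f y + dotv s y <= f x + dotv s x.
Proof.
move=> cK bf df Kx0.
pose F x := f x + dotv s x.
pose S := [set x | K° x /\ F x <= F x0].
have clK : closed K by apply: compact_closed => //; exact: norm_hausdorff.
have cF x : K° x -> {for x, continuous F}.
  move=> Kx; have cf := differentiable_continuous (df x Kx).
  by apply: continuousD => //; exact: dotv_continuous.
have clS : closed S.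
  move=> p pS.
  have Kp : K p.
    by rewrite (closure_id K).1//; move: p pS; apply: closureS => x [/interior_subset].
  have [Kp'|nKp] := pselect (K° p).
    split=> //; rewrite leNgt; apply/negP => Fp.
    have := cF _ Kp' _ (open_nbhs_nbhs (conj (@open_gt _ (F x0)) Fp)).
    by move=> /pS[q [[_ Fq]]] /=; rewrite ltNge Fq.
  exfalso.
  have /choice[x_ Hx] : forall k : nat, exists x, S x /\ ball p (k.+1%:R^-1 : R) x.
    move=> k; have k0 : 0 < (k.+1%:R : R)^-1 by rewrite invr_gt0.
    have [x [Sx bx]] := pS _ (nbhsx_ballx p _ k0).
    by exists x.
  have cx : x_ @ \oo --> p.
    apply/cvg_ballP => e e0; near=> k.
    apply: le_ball (Hx k).2; apply: ltW.
    by near: k; exact: near_infty_natSinv_lt (PosNum e0).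
  have bp : boundary K p by split=> //; exact: subset_closure.
  have fy := bf x_ p (fun k => (Hx k).1.1) cx bp.
  have sy : dotv s (x_ k) @[k --> \oo] --> dotv s p.
    by apply: (cvg_comp _ _ cx); exact: dotv_continuous.
  have /cvgryPgt/(_ (F x0 - (dotv s p - 1))) f1 := fy.
  have s1 : \forall k \near \oo, dotv s p - 1 < dotv s (x_ k).
    by apply: (cvgr_gt _ sy); rewrite gtrBl.
  have [k [fk sk]] := filter_ex (filterI f1 s1).
  by have := (Hx k).1.2; rewrite /F in fk *; lra.
have cS : compact S.
  by apply: (subclosed_compact clS cK) => x [/interior_subset].
have [||y] := compact_EVT_min (f := F) _ cS.
- by exists x0.
- by apply: continuous_in_subspaceT => x /set_mem[Kx _]; exact: cF.
rewrite inE => -[Ky Fy] ymin; exists y => // x Kx.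
have [Fx|Fx] := leP (F x) (F x0); first by apply: ymin; rewrite inE.
by rewrite (le_trans Fy)// ltW.
Unshelve. all: by end_near. Qed.

Lemma tilt_min_gradient K f s y v : (forall x, K° x -> differentiable f x) ->
  K° y -> (forall x, K° x -> f y + dotv s y <= f x + dotv s x) ->
  dotv (gradient f y + s) v = 0.
Proof.
move=> df Ky ymin.
have [e e0 He] := interior_line_nbhs v Ky.
pose G (t : R) := f (y + t *: v) + dotv s (y + t *: v).
have dG (t : R) : `|t| < e ->
    is_derive t 1 G (dotv (gradient f (y + t *: v)) v + dotv s v).
  move=> te; have Kt := He t te.
  have d1 : derivable f (y + t *: v) v by apply: diff_derivable; exact: df.
  have := is_deriveD (is_derive_line d1) (is_derive_affine (dotv s y) (dotv s v) t).
  rewrite derive_gradient; last exact: df.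
  congr is_derive; apply/funext => r.
  by rewrite /G dotvDr dotvZr.
have e1 : - e <= e by lra.
have G0 : is_derive (0 : R) 1 G 0.
  apply: (derive1_at_min e1); rewrite ?in_itv/= ?oppr_lt0 ?e0//.
  - by move=> t; rewrite in_itv/= -ltr_norml => /dG[].
  - move=> t; rewrite in_itv/= -ltr_norml => te.
    by rewrite /G scale0r addr0; apply: ymin; exact: He.
have d0 : `|0 : R| < e by rewrite normr0.
have [_ G0'] := G0; have [_] := dG 0 d0.
by rewrite G0' scale0r addr0 dotvDl => <-.
Qed.

End ConvexBodies.

(** * Self-concordance *)

Section Taylor.
Context {R : realType}.

Lemma is_derive_cubic (a b c e t : R) :
  is_derive t 1 (fun s => a + b * s + c * s ^+ 2 + e * s ^+ 3)
    (b + 2 * c * t + 3 * e * t ^+ 2).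
Proof.
have i := is_derive_id t (1 : R).
have := is_deriveD (is_deriveD (is_deriveD (is_derive_cst a t 1)
  (is_deriveZ b i)) (is_deriveZ c (is_deriveX 2 i))) (is_deriveZ e (is_deriveX 3 i)).
set D := (X in is_derive _ _ _ X) => H.
suff <- : D = b + 2 * c * t + 3 * e * t ^+ 2 by [].
by rewrite /D /GRing.scale/= add0r expr1; ring.
Qed.

(** The affine bound [A + B t] is integrated twice, giving [A t^2 / 2 + B t^3 / 6] at [t = 1]. *)
Lemma taylor2_le (p0 p1 p2 : R -> R) (A B : R) :
  (forall t : R, 0 <= t <= 1 -> is_derive t 1 p0 (p1 t)) ->
  (forall t : R, 0 <= t <= 1 -> is_derive t 1 p1 (p2 t)) ->
  (forall t : R, 0 <= t <= 1 -> p2 t <= A + B * t) ->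
  p0 1 - p0 0 - p1 0 <= A / 2 + B / 6.
Proof.
move=> d0 d1 pAB.
have p1t (t : R) : 0 <= t <= 1 -> p1 t <= p1 0 + A * t + B / 2 * t ^+ 2.
  move=> /andP[t0 t1].
  have sub (s : R) : 0 <= s <= t -> 0 <= s <= 1.
    by move=> /andP[-> st]; rewrite (le_trans st).
  have dq (s : R) : 0 <= s <= t -> is_derive s 1
      (fun s => 0 + A * s + B / 2 * s ^+ 2 + 0 * s ^+ 3) (A + B * s).
    move=> _; have := is_derive_cubic 0 A (B / 2) 0 s.
    by congr is_derive; field.
  have := ler_increment t0 (fun s st => d1 s (sub s st)) dq
    (fun s st => pAB s (sub s st)).
  by lra.
have dq (s : R) : 0 <= s <= 1 -> is_derive s 1
    (fun s => 0 + p1 0 * s + A / 2 * s ^+ 2 + B / 6 * s ^+ 3)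
    (p1 0 + A * s + B / 2 * s ^+ 2).
  move=> _; have := is_derive_cubic 0 (p1 0) (A / 2) (B / 6) s.
  by congr is_derive; field.
have := ler_increment ler01 d0 dq p1t.
by rewrite !expr1n expr0n/= expr0n/=; lra.
Qed.

Lemma taylor2_ge (p0 p1 p2 : R -> R) (A B : R) :
  (forall t : R, 0 <= t <= 1 -> is_derive t 1 p0 (p1 t)) ->
  (forall t : R, 0 <= t <= 1 -> is_derive t 1 p1 (p2 t)) ->
  (forall t : R, 0 <= t <= 1 -> A + B * t <= p2 t) ->
  A / 2 + B / 6 <= p0 1 - p0 0 - p1 0.
Proof.
move=> d0 d1 pAB.
have := @taylor2_le (- p0) (- p1) (- p2) (- A) (- B).
rewrite -![(- _ : R -> R) _]/(- (_ _)) => H.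
suff : - p0 1 - - p0 0 - - p1 0 <= - A / 2 + - B / 6 by lra.
apply: H => t t01.
- by apply: is_deriveN; exact: d0.
- by apply: is_deriveN; exact: d1.
- by rewrite -[(- p2) t]/(- (p2 t)); have := pAB t t01; lra.
Qed.

Lemma inv_dist_le (a b c : R) : 0 < a -> 0 < b -> `|a^-1 - b^-1| <= c ->
  b <= a * (1 + c * b) /\ a * (1 - c * b) <= b.
Proof.
move=> a0 b0; have ab : 0 <= a * b by rewrite mulr_ge0 ?ltW.
have e : a * b * (a^-1 - b^-1) = b - a by field; rewrite !gt_eqF.
rewrite ler_norml => /andP[/(ler_wpM2l ab) l1 /(ler_wpM2l ab) l2].
by rewrite e in l1 l2; split; lra.
Qed.

End Taylor.

Lemma class_C_pred (R : realType) (d k : nat) (U : set 'cV[R]_d) (g : 'cV[R]_d -> R) :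
  class_C k.+1 U g -> class_C k U g.
Proof.
elim: k g => [|k IHk] g [dg cg]; first by move=> x /dg/differentiable_continuous.
by split=> // v; exact: IHk.
Qed.

(* The gradient [G] and the Hessian [Hs] are left abstract: unification would
   otherwise unfold the derivatives in [gradient] and [hessian]. *)
Record sc_calculus (R : realType) (d : nat) (U : set 'cV[R]_d)
    (f : 'cV[R]_d -> R) (G : 'cV[R]_d -> 'cV[R]_d) (Hs : 'cV[R]_d -> 'M[R]_d)
    (M : R) : Prop := ScCalculus {
  scc_gt0 : 0 < M;
  scc_convex : forall x y (t : R), U x -> U y -> 0 <= t <= 1 ->
    U (x + t *: (y - x));
  scc_pdef : forall x, U x -> pdef (Hs x);
  scc_derive0 : forall x h (t : R), U (x + t *: h) ->
    is_derive t 1 (fun s => f (x + s *: h)) (dotv (G (x + t *: h)) h);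
  scc_derive1 : forall x h z (t : R), U (x + t *: h) ->
    is_derive t 1 (fun s => dotv (G (x + s *: h)) z)
      (dotv h (Hs (x + t *: h) *m z));
  scc_growth : forall x h (t : R), 0 <= t <= 1 ->
    (forall r : R, 0 <= r <= 1 -> U (x + r *: h)) ->
    mnorm (Hs x) h <= mnorm (Hs (x + t *: h)) h * (1 + M * t * mnorm (Hs x) h) /\
    mnorm (Hs (x + t *: h)) h * (1 - M * t * mnorm (Hs x) h) <= mnorm (Hs x) h;
  scc_dikin : forall x h, U x -> M * mnorm (Hs x) h < 1 -> U (x + h)
}.

(** * Growth of the local norm along lines and the Dikin ellipsoid *)

Section SelfConcordance.
Context {R : realType} {d : nat} (K : set 'cV[R]_d) (f : 'cV[R]_d -> R) (M : R).
Implicit Types (x y w h z u v : 'cV[R]_d) (s t r : R).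
Hypotheses (cK : convex_set K) (M_gt0 : 0 < M) (scf : self_concordant K M f).
Hypothesis pH : forall x, K° x -> pdef (hessian f x).

Let N x h := mnorm (hessian f x) h.

Let N_ge0 x h : 0 <= N x h. Proof. exact: mnorm_ge0. Qed.

Lemma self_concordant_differentiable x : K° x -> differentiable f x.
Proof. by case: scf => _ _ [df _] _ _; exact: df. Qed.

Lemma self_concordant_blows_up : blows_up K f.
Proof. by case: scf. Qed.

Lemma is_derive_line0 x h t : K° (x + t *: h) ->
  is_derive t 1 (fun s => f (x + s *: h)) (dotv (gradient f (x + t *: h)) h).
Proof.
move=> Kt; have df := self_concordant_differentiable Kt.
by rewrite -derive_gradient//; apply: is_derive_line; exact: diff_derivable.
Qed.

Lemma is_derive_line1 x h z t : K° (x + t *: h) ->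
  is_derive t 1 (fun s => dotv (gradient f (x + s *: h)) z)
    (dotv h (hessian f (x + t *: h) *m z)).
Proof.
move=> Kt; case: scf => _ _ c3 _ _.
have c2 := class_C_pred c3.
have oK := @open_interior _ K.
rewrite -(derive2_hessian h z oK c2 Kt).
apply: (@near_eq_is_derive _ _ _ (fun s => 'D_z f (x + s *: h))).
  apply: filterS (near_line Kt) => s Ks; rewrite derive_gradient//.
  exact: self_concordant_differentiable.
apply: is_derive_line; apply: diff_derivable.
by case: c3 => _ /(_ z)[+ _]; apply.
Qed.

Lemma is_derive_line2 x h t : K° (x + t *: h) ->
  is_derive t 1 (fun s => dotv h (hessian f (x + s *: h) *m h))
    ('D_h ('D_h ('D_h f)) (x + t *: h)).
Proof.
move=> Kt; case: scf => _ _ c3 _ _.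
have c2 := class_C_pred c3.
have oK := @open_interior _ K.
apply: (@near_eq_is_derive _ _ _ (fun s => 'D_h ('D_h f) (x + s *: h))).
  by apply: filterS (near_line Kt) => s Ks; rewrite (derive2_hessian h h oK c2 Ks).
apply: is_derive_line; apply: diff_derivable.
by case: c3 => _ /(_ h)[_ /(_ h)[+ _]]; apply.
Qed.

Lemma local_norm_growth x h t : 0 <= t ->
  (forall r, 0 <= r <= t -> K° (x + r *: h)) ->
  N x h <= N (x + t *: h) h * (1 + M * t * N x h) /\
  N (x + t *: h) h * (1 - M * t * N x h) <= N x h.
Proof.
move=> t0 Kseg.
(* The zero direction is set aside because the growth estimate divides by the local norm. *)
have [->|h0] := eqVneq h 0; first by rewrite scaler0 addr0 /N mnorm0 !mul0r.
have d2 r (rt : 0 <= r <= t) := is_derive_line2 (Kseg r rt).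
have := self_concordant_growth (M := M) t0 d2.
rewrite scale0r addr0 subr0 => /(_ _ _)H.
have Kx : K° x by have := Kseg 0; rewrite lexx t0 scale0r addr0; apply.
have Nx : 0 < N x h by apply: mnorm_gt0 => //; exact: pH.
have Nt : 0 < N (x + t *: h) h.
  by apply: mnorm_gt0 => //; apply: pH; apply: Kseg; rewrite t0 lexx.
have : `|(N (x + t *: h) h)^-1 - (N x h)^-1| <= M * t.
  apply: H => r /Kseg Kr; first by have [_] := pH Kr; apply.
  by case: scf => _ _ _ _ /(_ _ h Kr).
exact: inv_dist_le.
Qed.

Lemma local_norm_segment x h t : 0 <= t <= 1 ->
  (forall r, 0 <= r <= 1 -> K° (x + r *: h)) ->
  N x h <= N (x + t *: h) h * (1 + M * t * N x h) /\
  N (x + t *: h) h * (1 - M * t * N x h) <= N x h.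
Proof.
move=> /andP[t0 t1] Kseg; apply: local_norm_growth => // r /andP[r0 rt].
by apply: Kseg; rewrite r0 (le_trans rt).
Qed.

(** If the segment left the interior, [f] would be unbounded on it before the exit time. But there
    the local norm of [h] is at most [r / (1 - M r)], so a second-order expansion bounds [f]. *)
Lemma dikin_ellipsoid x h : K° x -> M * N x h < 1 -> K° (x + h).
Proof.
move=> Kx Mr; apply: contrapT => nK.
have [t /andP[t0 t1] [inK ub]] := ray_blows_up cK self_concordant_blows_up Kx nK.
set r := N x h in Mr.
pose q := r / (1 - M * r).
have q1 : 0 < 1 - M * r by rewrite subr_gt0.
have [s /andP[s0 st]] := ub (f x + `|dotv (gradient f x) h| + q ^+ 2 / 2).
rewrite ltNge => /negP; apply.
have s1 : s <= 1 by rewrite ltW// (lt_le_trans st).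
have Kseg e : 0 <= e <= 1 -> K° (x + e *: (s *: h)).
  move=> /andP[e0 e1]; rewrite scalerA; apply: inK.
  rewrite mulr_ge0//= (le_lt_trans _ st)// -[leRHS]mul1r.
  by rewrite ler_wpM2r.
have rs : N x (s *: h) = s * r by rewrite /N mnormZ ger0_norm.
have := @taylor2_le _ (fun e => f (x + e *: (s *: h)))
  (fun e => dotv (gradient f (x + e *: (s *: h))) (s *: h))
  (fun e => dotv (s *: h) (hessian f (x + e *: (s *: h)) *m (s *: h))) (q ^+ 2) 0.
rewrite scale1r scale0r addr0 mul0r addr0.
have le_s : dotv (gradient f x) (s *: h) <= `|dotv (gradient f x) h|.
  rewrite dotvZr (le_trans (ler_norm _))// normrM (ger0_norm s0).
  by rewrite -[leRHS]mul1r ler_wpM2r.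
suff H : forall e, 0 <= e <= 1 ->
    dotv (s *: h) (hessian f (x + e *: (s *: h)) *m (s *: h)) <= q ^+ 2 + 0 * e.
  move=> /(_ _ _ H) H'.
  have : f (x + s *: h) - f x - dotv (gradient f x) (s *: h) <= q ^+ 2 / 2.
    by apply: H' => e /Kseg; [exact: is_derive_line0|exact: is_derive_line1].
  by lra.
move=> e e01; have [_ H] := local_norm_segment e01 Kseg.
have Ke := Kseg e e01.
rewrite mul0r addr0 -sqr_mnorm; last exact/pdef_psd/pH.
have r0 : 0 <= r := N_ge0 x h.
have q0 : 0 <= q := divr_ge0 r0 (ltW q1).
apply: lerXn2r; [by rewrite nnegrE mnorm_ge0 | by rewrite nnegrE q0 |].
rewrite /q (ler_pdivlMr _ _ q1).
rewrite rs in H.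
have sr : s * r <= r := ler_piMl r0 s1.
apply: (le_trans _ sr); apply: (le_trans _ H).
apply: (ler_wpM2l (N_ge0 _ _)).
rewrite lerD2l lerN2 -mulrA (ler_pM2l M_gt0); case/andP: e01 => _ e1.
exact: (le_trans (ler_piMl (mulr_ge0 s0 r0) e1) sr).
Qed.

Lemma self_concordant_calculus :
  sc_calculus K° f (gradient f) (hessian f) M.
Proof.
split; [exact: M_gt0 | | exact: pH | exact: is_derive_line0 |
  exact: is_derive_line1 | exact: local_norm_segment | exact: dikin_ellipsoid].
by move=> x y t; exact: interior_segmentW.
Qed.

End SelfConcordance.

(** * Scalar inequalities for Hessian stability and the Newton decrement *)

Section RealEstimates.
Context {R : realType}.
Implicit Types (a b e r M t k n : R).

(** With [x = M r t <= 1/10], this rests on [(1 + x)^-2 >= 1 - 2 x] and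
    [(1 - x)^-2 <= 1 + 5/2 x]. *)
Lemma sqr_growth_bounds M r a t : 0 < M -> 0 <= r -> 0 <= a -> 0 <= t <= 1 ->
  M * r <= 1 / 10 -> r <= a * (1 + M * t * r) -> a * (1 - M * t * r) <= r ->
  r ^+ 2 - 5 / 2 * M * r ^+ 3 * t <= a ^+ 2 <= r ^+ 2 + 5 / 2 * M * r ^+ 3 * t.
Proof.
move=> M0 r0 a0 /andP[t0 t1] Mr ra ar.
pose x := M * r * t.
have x0 : 0 <= x by rewrite /x !mulr_ge0// ltW.
have x1 : x <= 1 / 10 by rewrite (le_trans _ Mr)// /x ler_piMr// mulr_ge0// ltW.
have -> : 5 / 2 * M * r ^+ 3 * t = r ^+ 2 * (5 / 2 * x) by rewrite /x; ring.
have ra' : r <= a * (1 + x) by rewrite /x mulrAC.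
have ar' : a * (1 - x) <= r by rewrite /x mulrAC.
have a2 := sqr_ge0 a; have r2 := sqr_ge0 r.
have ra2 : r ^+ 2 <= a ^+ 2 * (1 + x) ^+ 2.
  by rewrite -exprMn lerXn2r ?nnegrE// mulr_ge0//; lra.
have ar2 : a ^+ 2 * (1 - x) ^+ 2 <= r ^+ 2.
  by rewrite -exprMn lerXn2r ?nnegrE// mulr_ge0//; lra.
have xx : 0 <= x ^+ 2 <= x / 10 by rewrite sqr_ge0 expr2 ler_wpM2l//; lra.
have xxx : 0 <= x ^+ 3 by rewrite exprn_ge0.
apply/andP; split.
  have k1 : (1 + x) ^+ 2 * (1 - 2 * x) <= 1.
    have -> : (1 + x) ^+ 2 * (1 - 2 * x) = 1 - 3 * x ^+ 2 - 2 * x ^+ 3 by ring.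
    lra.
  have l1 : r ^+ 2 * (1 - 2 * x) <= a ^+ 2 * (1 + x) ^+ 2 * (1 - 2 * x).
    by apply: ler_wpM2r => //; lra.
  have l2 : a ^+ 2 * ((1 + x) ^+ 2 * (1 - 2 * x)) <= a ^+ 2 by rewrite ler_piMr.
  have l3 : 0 <= r ^+ 2 * x by rewrite mulr_ge0.
  by rewrite mulrA in l2; lra.
have k1 : 1 <= (1 - x) ^+ 2 * (1 + 5 / 2 * x).
  have -> : (1 - x) ^+ 2 * (1 + 5 / 2 * x) =
    1 + x / 2 - 4 * x ^+ 2 + 5 / 2 * x ^+ 3 by field.
  lra.
have l1 : a ^+ 2 * (1 - x) ^+ 2 * (1 + 5 / 2 * x) <= r ^+ 2 * (1 + 5 / 2 * x).
  by apply: ler_wpM2r => //; lra.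
have l2 : a ^+ 2 <= a ^+ 2 * ((1 - x) ^+ 2 * (1 + 5 / 2 * x)) by rewrite ler_peMr.
by rewrite mulrA in l2; lra.
Qed.

Lemma relative_gap a b e k n : 0 < k -> 0 <= e -> 0 <= a -> 0 <= b ->
  n = Num.max a b -> `|k * b - k * a| <= e * (k * n) ->
  (1 - e) * b <= a /\ (1 - e) * a <= b.
Proof.
move=> k0 e0 a0 b0 nE.
rewrite -mulrBr normrM (gtr0_norm k0) mulrCA ler_pM2l// => H.
have := H; rewrite ler_norml nE => /andP[H1 H2].
move: H1 H2; case: (leP a b) => ab H1 H2; split; try lra.
- by have := mulr_ge0 e0 a0; lra.
- by have := mulr_ge0 e0 b0; lra.
Qed.

Lemma max_scaling a b r : 0 < a -> 0 <= b -> 0 < r ->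
  exists k, [/\ 0 < k, k * Num.max a b = 2 * r, k * a <= 2 * r & k * b <= 2 * r].
Proof.
move=> a0 b0 r0; have n0 : 0 < Num.max a b by rewrite lt_max a0.
have k0 : 0 < 2 * r / Num.max a b by rewrite divr_gt0// mulr_gt0.
have kn : 2 * r / Num.max a b * Num.max a b = 2 * r by rewrite divfK// gt_eqF.
exists (2 * r / Num.max a b); split=> //.
  by rewrite -[leRHS]kn ler_pM2l// le_max lexx.
by rewrite -[leRHS]kn ler_pM2l// le_max lexx orbT.
Qed.

(** By homogeneity: with the larger norm scaled to [2 r], the error [30 M r^3] is [15/2 M r] times
    its square. *)
Lemma gap_relative M r k a b : 0 < M -> 0 < r -> 0 < k -> 0 <= a -> 0 <= b ->
  k * Num.max a b = 2 * r -> `|(k * b) ^+ 2 - (k * a) ^+ 2| <= 30 * M * r ^+ 3 ->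
  (1 - 15 / 2 * (M * r)) * b ^+ 2 <= a ^+ 2 /\
  (1 - 15 / 2 * (M * r)) * a ^+ 2 <= b ^+ 2.
Proof.
move=> M0 r0 k0 a0 b0 kn; rewrite !exprMn.
have -> : 30 * M * r ^+ 3 = 15 / 2 * (M * r) * (k ^+ 2 * Num.max a b ^+ 2).
  by rewrite -exprMn kn; field.
apply: relative_gap; rewrite ?exprn_gt0 ?sqr_ge0//.
  by rewrite !mulr_ge0// ltW.
case: (leP a b) => ab; apply/esym; [apply: max_r | apply: max_l].
  by rewrite lerXn2r ?nnegrE.
by rewrite lerXn2r ?nnegrE ?(ltW ab).
Qed.

Lemma stability_radius M r : 0 <= r -> M * r <= 1 / 30 ->
  [/\ M * r < 1, r + 2 * r <= 3 * r, r <= 3 * r, 2 * r <= 3 * r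
    & M * (3 * r) <= 1 / 10].
Proof. by move=> r0 Mr; split; lra. Qed.

(** The quadratic parts leave [ny^2 - nv^2]. The cubic errors carry weights
    [27 + 27 + 2 + 8 + 8 = 72], and [72 * 5/12 = 30]. *)
Lemma gap_of_bregman M r (D1 D2 D3 D4 D5 np nm nu nv ny : R) :
  `|D1 - np ^+ 2 / 2| <= 5 / 12 * M * np ^+ 3 ->
  `|D2 - nm ^+ 2 / 2| <= 5 / 12 * M * nm ^+ 3 ->
  `|D3 - nu ^+ 2 / 2| <= 5 / 12 * M * nu ^+ 3 ->
  `|D4 - ny ^+ 2 / 2| <= 5 / 12 * M * ny ^+ 3 ->
  `|D5 - ny ^+ 2 / 2| <= 5 / 12 * M * ny ^+ 3 ->
  D1 + D2 - 2 * D3 = D4 + D5 ->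
  np ^+ 2 + nm ^+ 2 = 2 * nu ^+ 2 + 2 * nv ^+ 2 ->
  M * np ^+ 3 <= 3 ^+ 3 * (M * r ^+ 3) ->
  M * nm ^+ 3 <= 3 ^+ 3 * (M * r ^+ 3) ->
  M * nu ^+ 3 <= 1 ^+ 3 * (M * r ^+ 3) ->
  M * ny ^+ 3 <= 2 ^+ 3 * (M * r ^+ 3) ->
  `|ny ^+ 2 - nv ^+ 2| <= 30 * M * r ^+ 3.
Proof.
rewrite !ler_norml => /andP[? ?] /andP[? ?] /andP[? ?] /andP[? ?] /andP[? ?].
by move=> *; apply/andP; split; lra.
Qed.

(** An antiderivative of the lower bound that [scc_growth] gives for the second derivative along a
    segment. *)
Lemma is_derive_hyperbola (M n t : R) : M != 0 -> 0 < 1 + M * n * t ->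
  is_derive t 1 (fun s => - M^-1 * n * (1 + s * (M * n))^-1)
    ((n / (1 + M * n * t)) ^+ 2).
Proof.
move=> M0 p0.
have nz : 1 + t * (M * n) != 0 by rewrite mulrC gt_eqF.
have := is_deriveZ (- M^-1 * n) (is_deriveV (f := fun s => 1 + s * (M * n)) nz
  (is_derive_affine 1 (M * n) t)).
congr is_derive; rewrite /GRing.scale/= (mulrC t).
by field; rewrite M0 gt_eqF.
Qed.

End RealEstimates.

(** * Bregman divergences, Hessian stability and the Newton decrement *)

Section SelfConcordanceLocal.
Context {R : realType} {d : nat} (U : set 'cV[R]_d) (f : 'cV[R]_d -> R).
Context (G : 'cV[R]_d -> 'cV[R]_d) (Hs : 'cV[R]_d -> 'M[R]_d) (M : R).
Hypothesis scc : sc_calculus U f G Hs M.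
Implicit Types (x y w h z u v s : 'cV[R]_d) (t r : R).

Let N x h := mnorm (Hs x) h.

Let N_ge0 x h : 0 <= N x h. Proof. exact: mnorm_ge0. Qed.

Let sqrN x h : U x -> N x h ^+ 2 = dotv h (Hs x *m h).
Proof. by move=> Ux; rewrite sqr_mnorm//; exact/pdef_psd/(scc_pdef scc). Qed.

Let M_gt0 : 0 < M. Proof. exact: scc_gt0 scc. Qed.

Lemma dikin_segment x h t : U x -> M * N x h < 1 -> 0 <= t <= 1 ->
  U (x + t *: h).
Proof.
move=> Ux Mr /andP[t0 t1]; apply: (scc_dikin scc Ux).
rewrite mnormZ (ger0_norm t0); apply: le_lt_trans Mr.
exact: (ler_wpM2l (ltW M_gt0) (ler_piMl (N_ge0 x h) t1)).
Qed.

Definition bregman x y := f y - f x - dotv (G x) (y - x).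

(** Along the segment the second derivative is [r^2] up to [5/2 M r^3 t], with [r = N x h]; two
    integrations divide the error coefficient by 6. *)
Lemma bregman_quadratic x h : U x -> M * N x h <= 1 / 10 ->
  `|bregman x (x + h) - N x h ^+ 2 / 2| <= 5 / 12 * M * N x h ^+ 3.
Proof.
move=> Ux Mr.
have Mr1 : M * N x h < 1 by apply: (le_lt_trans Mr); lra.
have Useg r (r01 : 0 <= r <= 1) := dikin_segment Ux Mr1 r01.
have d0 r (r01 : 0 <= r <= 1) := scc_derive0 scc (Useg r r01).
have d1 r (r01 : 0 <= r <= 1) := scc_derive1 scc h (Useg r r01).
have b r (r01 : 0 <= r <= 1) :
    N x h ^+ 2 - 5 / 2 * M * N x h ^+ 3 * r <=
      dotv h (Hs (x + r *: h) *m h)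
    <= N x h ^+ 2 + 5 / 2 * M * N x h ^+ 3 * r.
  rewrite -(sqrN h (Useg r r01)).
  have [l1 l2] := scc_growth scc r01 Useg.
  exact: sqr_growth_bounds M_gt0 (N_ge0 x h) (N_ge0 _ h) r01 Mr l1 l2.
have bl r (r01 : 0 <= r <= 1) : N x h ^+ 2 + (- (5 / 2 * M * N x h ^+ 3)) * r <=
    dotv h (Hs (x + r *: h) *m h).
  by rewrite mulNr; case/andP: (b r r01).
have bu r (r01 : 0 <= r <= 1) : dotv h (Hs (x + r *: h) *m h) <=
    N x h ^+ 2 + 5 / 2 * M * N x h ^+ 3 * r.
  by case/andP: (b r r01).
have := taylor2_le d0 d1 bu; have := taylor2_ge d0 d1 bl.
rewrite scale1r scale0r addr0 /bregman (addrAC x h) subrr add0r.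
move: (N x h) (f _ - _ - _) => q D; rewrite ler_norml; lra.
Qed.

(** Value and gradient at [x] cancel: both sides are the second difference
    [f (y + v) + f (y - v) - 2 f y]. *)
Lemma bregman_parallelogram x y v :
  bregman x (y + v) + bregman x (y - v) - 2 * bregman x y =
  bregman y (y + v) + bregman y (y - v).
Proof.
rewrite /bregman (addrAC y v (- y)) (addrAC y (- v) (- y)) subrr !add0r.
by rewrite !dotvBr !dotvDr !dotvNr; ring.
Qed.

Lemma hessian_gap x y v r : U x -> N x (y - x) <= r -> M * r <= 1 / 30 ->
  N x v <= 2 * r -> N y v <= 2 * r ->
  `|N y v ^+ 2 - N x v ^+ 2| <= 30 * M * r ^+ 3.
Proof.
move=> Ux xy Mr xv yv.
have M0 := ltW M_gt0.
have r0 : 0 <= r := le_trans (N_ge0 x (y - x)) xy.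
have [Mr1 r3 r13 r23 Mr3] := stability_radius r0 Mr.
have small n : n <= 3 * r -> M * n <= 1 / 10.
  by move=> n3; exact: le_trans (ler_wpM2l M0 n3) Mr3.
have cube n k : 0 <= n -> n <= k * r -> 0 <= k -> M * n ^+ 3 <= k ^+ 3 * (M * r ^+ 3).
  move=> n0 nk k0; rewrite (mulrCA (k ^+ 3) M) -exprMn; apply: (ler_wpM2l M0).
  by apply: lerXn2r => //; rewrite nnegrE ?mulr_ge0.
set u := y - x in xy.
have yE : y = x + u by rewrite addrC subrK.
have psdx := pdef_psd (scc_pdef scc Ux).
have Uy : U y.
  rewrite yE; apply: (scc_dikin scc Ux).
  exact: le_lt_trans (ler_wpM2l M0 xy) Mr1.
have uv : N x (u + v) <= 3 * r.
  exact: (le_trans (ler_mnormD u v psdx) (le_trans (lerD xy xv) r3)).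
have uv' : N x (u - v) <= 3 * r.
  apply: (le_trans (ler_mnormD u (- v) psdx)); rewrite mnormN.
  exact: (le_trans (lerD xy xv) r3).
have b1 := bregman_quadratic Ux (small _ uv).
have b2 := bregman_quadratic Ux (small _ uv').
have xy3 : N x u <= 3 * r := le_trans xy r13.
have b3 := bregman_quadratic Ux (small _ xy3).
have yv3 : N y v <= 3 * r := le_trans yv r23.
have b4 := bregman_quadratic Uy (small _ yv3).
have nNv : N y (- v) = N y v := mnormN _ _.
have b5 := bregman_quadratic (h := - v) Uy; rewrite -/N nNv in b5.
have {}b5 := b5 (small _ yv3).
rewrite addrA -yE in b1; rewrite addrA -yE in b2; rewrite -yE in b3.
have para := bregman_parallelogram x y v.
have q1 : N x (u + v) ^+ 2 + N x (u - v) ^+ 2 = 2 * N x u ^+ 2 + 2 * N x v ^+ 2.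
  rewrite !(sqrN _ Ux) (quadD u v psdx.1) (quadD u (- v) psdx.1).
  by rewrite !mulmxN !dotvNr !dotvNl !opprK; ring.
have c1 := cube _ _ (N_ge0 x (u + v)) uv (ler0n _ 3).
have c2 := cube _ _ (N_ge0 x (u - v)) uv' (ler0n _ 3).
have xy1 : N x u <= 1 * r by rewrite mul1r.
have c3 := cube _ _ (N_ge0 x u) xy1 ler01.
have c4 := cube _ _ (N_ge0 y v) yv (ler0n _ 2).
exact: gap_of_bregman b1 b2 b3 b4 b5 para q1 c1 c2 c3 c4.
Qed.

(** Scaling [v] so that the larger of its norms at [x] and [y] is [2 r] turns the cubic error of
    [hessian_gap] into a relative one. *)
Lemma hessian_stability x y v r : U x -> 0 < r -> N x (y - x) <= r ->
  M * r <= 1 / 30 ->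
  (1 - 15 / 2 * (M * r)) * dotv v (Hs y *m v) <= dotv v (Hs x *m v)
  /\ (1 - 15 / 2 * (M * r)) * dotv v (Hs x *m v)
     <= dotv v (Hs y *m v).
Proof.
move=> Ux r0 xy Mr.
have [Mr1 _ _ _ _] := stability_radius (ltW r0) Mr.
have [->|v0] := eqVneq v 0.
  have e (A : 'M[R]_d) : dotv 0 (A *m 0) = 0 by rewrite mulmx0 dotv0r.
  by rewrite !e mulr0; split; exact: lexx.
have Uy : U y.
  rewrite -(subrK x y) addrC; apply: (scc_dikin scc Ux).
  exact: le_lt_trans (ler_wpM2l (ltW M_gt0) xy) Mr1.
have Nx : 0 < N x v := mnorm_gt0 (scc_pdef scc Ux) v0.
have [k [k0 kn xk yk]] := max_scaling Nx (N_ge0 y v) r0.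
have Nk z : N z (k *: v) = k * N z v by rewrite /N mnormZ (gtr0_norm k0).
rewrite -(Nk x) in xk; rewrite -(Nk y) in yk.
have := hessian_gap Ux xy Mr xk yk; rewrite -/N (Nk x) (Nk y) -(sqrN v Ux) -(sqrN v Uy).
exact: gap_relative M_gt0 r0 k0 (N_ge0 x v) (N_ge0 y v) kn.
Qed.

(** With [h = y - w] and [n] its norm at [w], the slope of [f] along [h] rises by at most [r n] from
    [w] to [y]. By [scc_growth] it rises by at least the integral of [(n / (1 + M n t))^2], that is
    [n^2 / (1 + M n)]. *)
Lemma newton_decrement_dist w y s r : U w -> U y -> 0 <= r -> M * r < 1 ->
  (forall h, `|dotv (G w + s) h| <= r * N w h) ->
  (forall h, dotv (G y + s) h = 0) ->
  N w (y - w) * (1 - M * r) <= r.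
Proof.
move=> Uw Uy r0 Mr gw gy.
set h := y - w.
have yE : y = w + 1 *: h by rewrite scale1r addrC subrK.
have Useg t (t01 : 0 <= t <= 1) : U (w + t *: h) := scc_convex scc Uw Uy t01.
have d1 t (t01 : 0 <= t <= 1) := scc_derive1 scc h (Useg t t01).
set n := N w h; have n0 : 0 <= n := N_ge0 w h.
have up : dotv (G y) h - dotv (G w) h <= r * n.
  have := gw h; rewrite -/n dotvDl ler_norml => /andP[g1 _].
  by have := gy h; rewrite dotvDl; lra.
have Mn0 : 0 <= M * n := mulr_ge0 (ltW M_gt0) n0.
have pos t : 0 <= t -> 0 < 1 + M * n * t.
  by move=> t0; rewrite ltr_pwDl// mulr_ge0.
have dG t : 0 <= t <= 1 -> is_derive t 1 (fun t => - M^-1 * n * (1 + t * (M * n))^-1)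
    ((n / (1 + M * n * t)) ^+ 2).
  by move=> /andP[t0 _]; exact: is_derive_hyperbola (lt0r_neq0 M_gt0) (pos t t0).
have := ler_increment ler01 dG d1.
rewrite -yE scale0r addr0 mul0r addr0 mul1r => H.
have {H} low : - M^-1 * n * (1 + M * n)^-1 - - M^-1 * n * 1^-1 <=
    dotv (G y) h - dotv (G w) h.
  apply: H => t t01; have [t0 t1] := andP t01.
  have [l1 _] := scc_growth scc t01 Useg.
  rewrite -(sqrN h (Useg t t01)).
  apply: lerXn2r; rewrite ?nnegrE; [exact: divr_ge0 n0 (ltW (pos t t0)) | exact: N_ge0 |].
  by rewrite (ler_pdivrMr _ _ (pos t t0)) mulrAC.
have p1 : 0 < 1 + M * n by have := pos 1 ler01; rewrite mulr1.
have {}low : n ^+ 2 / (1 + M * n) <= r * n.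
  apply: le_trans up; apply: le_trans low; rewrite le_eqVlt; apply/orP; left; apply/eqP.
  by field; rewrite (lt0r_neq0 M_gt0) (lt0r_neq0 p1).
move: low; rewrite (ler_pdivrMr _ _ p1); move: n0; rewrite le_eqVlt.
move=> /predU1P[<-|n0]; first by rewrite mul0r.
rewrite expr2 (mulrC r) -mulrA (ler_pM2l n0).
lra.
Qed.

End SelfConcordanceLocal.

(** * Growth of a barrier along segments and a lower bound on its parameter *)

Section BarrierSlope.
Context {R : realType}.
Implicit Types (p : R -> R) (nu t : R).

(** The inequality [p^2 <= nu p'] says that [-1/p] grows at rate at least [1/nu]. If the bound
    failed, the positive quantity [1/p] would be driven down to zero by the time
    [s' = s + nu / p s], which is still below 1. *)
Lemma barrier_slope p p' nu s : 0 < nu -> 0 <= s < 1 ->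
  (forall t, 0 <= t < 1 -> is_derive t 1 p (p' t)) ->
  (forall t, 0 <= t < 1 -> 0 <= p' t) ->
  (forall t, 0 <= t < 1 -> p t ^+ 2 <= nu * p' t) ->
  p s * (1 - s) <= nu.
Proof.
move=> nu0 /andP[s0 s1] dp p'0 pnu; rewrite leNgt; apply/negP => H.
have ps : 0 < p s by rewrite -(pmulr_lgt0 _ (_ : 0 < 1 - s)) ?subr_gt0// (lt_trans nu0).
pose s' := s + nu / p s.
have ss' : s <= s' by rewrite lerDl divr_ge0// ltW.
have s'1 : s' < 1 by rewrite -ltrBrDl ltr_pdivrMr// mulrC.
have sub t : s <= t <= s' -> 0 <= t < 1.
  by move=> /andP[st ts]; rewrite (le_trans s0 st) (le_lt_trans ts s'1).
have pt t : s <= t <= s' -> p s <= p t.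
  move=> /andP[st ts].
  have sub' r : s <= r <= t -> 0 <= r < 1.
    by move=> /andP[sr rt]; apply: sub; rewrite sr (le_trans rt).
  have d0 r : s <= r <= t -> is_derive r 1 (cst 0) (0 : R).
    by move=> _; exact: is_derive_cst.
  have := ler_increment st d0 (fun r rt => dp r (sub' r rt))
    (fun r rt => p'0 r (sub' r rt)).
  by rewrite /cst; lra.
have dq t : s <= t <= s' -> is_derive t 1 (fun r => - (p r)^-1) (p' t / p t ^+ 2).
  move=> st; have ptn : p t != 0 by rewrite gt_eqF// (lt_le_trans ps)// pt.
  have := is_deriveN (is_deriveV ptn (dp t (sub t st))).
  congr is_derive; rewrite /GRing.scale/=.
  by field.
have da t : s <= t <= s' -> is_derive t 1 (fun r => 0 + r * nu^-1) nu^-1.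
  by move=> _; exact: is_derive_affine.
have lq t : s <= t <= s' -> nu^-1 <= p' t / p t ^+ 2.
  move=> st; have p0 : 0 < p t by rewrite (lt_le_trans ps)// pt.
  rewrite ler_pdivlMr ?exprn_gt0// mulrC ler_pdivrMr// mulrC.
  exact: pnu (sub t st).
have := ler_increment ss' da dq lq.
have ps' : 0 < p s' by rewrite (lt_le_trans ps)// pt// ss' lexx.
have : 0 < (p s')^-1 by rewrite invr_gt0.
have -> : 0 + s' * nu^-1 - (0 + s * nu^-1) = (p s)^-1.
  by rewrite /s'; field; rewrite !gt_eqF.
lra.
Qed.

Lemma is_derive_log_barrier nu t : t < 1 ->
  is_derive t 1 (fun s => - nu * ln (1 - s)) (nu / (1 - t)).
Proof.
move=> t1; have t0 : 0 < 1 + t * -1 by rewrite mulrN1 subr_gt0.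
have := is_deriveZ (- nu) (is_derive1_comp (f := @ln R)
  (g := fun s => 1 + s * -1) (is_derive1_ln t0) (is_derive_affine 1 (-1) t)).
congr is_derive; last by rewrite /GRing.scale/= !mulrN1 mulrNN.
by apply/funext => s; rewrite /= /GRing.scale/= mulrN1.
Qed.

End BarrierSlope.

Section Barrier.
Context {R : realType} {d : nat} (U : set 'cV[R]_d) (f : 'cV[R]_d -> R).
Context (G : 'cV[R]_d -> 'cV[R]_d) (Hs : 'cV[R]_d -> 'M[R]_d) (M nu : R).
Hypothesis scc : sc_calculus U f G Hs M.
Hypothesis nu_gt0 : 0 < nu.
Hypothesis Gnu : forall x h, U x ->
  `|dotv (G x) h| <= Num.sqrt nu * mnorm (Hs x) h.
Implicit Types (x y w h : 'cV[R]_d) (t : R).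

(** The bound [nu / (1 - r)] on the slope from [barrier_slope] has the antiderivative
    [- nu ln (1 - r)]. *)
Lemma barrier_growth x h t : (forall r, 0 <= r < 1 -> U (x + r *: h)) ->
  0 <= t < 1 -> f (x + t *: h) - f x <= nu * ln (1 / (1 - t)).
Proof.
move=> Ur /andP[t0 t1].
have d0 r (r01 : 0 <= r < 1) := scc_derive0 scc (Ur r r01).
have d1 r (r01 : 0 <= r < 1) := scc_derive1 scc h (Ur r r01).
have p2 r : 0 <= r < 1 -> 0 <= dotv h (Hs (x + r *: h) *m h).
  by move=> /Ur Uxr; apply: (pdef_psd (scc_pdef scc Uxr)).2.
have p1 r : 0 <= r < 1 ->
    dotv (G (x + r *: h)) h ^+ 2 <= nu * dotv h (Hs (x + r *: h) *m h).
  move=> /Ur Uxr; rewrite -sqr_mnorm; last exact: pdef_psd (scc_pdef scc Uxr).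
  have n0 : 0 <= Num.sqrt nu * mnorm (Hs (x + r *: h)) h.
    by rewrite mulr_ge0 ?sqrtr_ge0 ?mnorm_ge0.
  have := lerXn2r 2 (_ : _ \in Num.nneg) (_ : _ \in Num.nneg) (Gnu h Uxr).
  rewrite !nnegrE n0 normr_ge0 => /(_ isT isT).
  by rewrite exprMn real_normK ?num_real// sqr_sqrtr// ltW.
have sub r : 0 <= r <= t -> 0 <= r < 1.
  by move=> /andP[-> rt]; rewrite (le_lt_trans rt).
have slope r : 0 <= r <= t -> dotv (G (x + r *: h)) h <= nu / (1 - r).
  move=> /sub r01; have r1 : 0 < 1 - r by rewrite subr_gt0; case/andP: r01.
  by rewrite ler_pdivlMr//; exact: barrier_slope nu_gt0 r01 d1 p2 p1.
have dl r : 0 <= r <= t -> is_derive r 1 (fun s => - nu * ln (1 - s)) (nu / (1 - r)).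
  by move=> /sub/andP[_ r1]; exact: is_derive_log_barrier.
have := ler_increment t0 (fun r rt => d0 r (sub r rt)) dl slope.
rewrite scale0r addr0 subr0 ln1 mulr0 subr0 div1r lnV ?posrE ?subr_gt0//.
by rewrite mulNr mulrN.
Qed.

(* Were [M * sqrt nu < 1/2], every point would be so close to the minimizer [x],
   in its own local norm, that [U] would be stable under [w |-> 2 w - x]. *)
Lemma barrier_parameter_ge x : (0 < d)%N ->
  (exists B : R, forall y, U y -> `|y| <= B) ->
  nbhs x U -> U x -> (forall h, dotv (G x) h = 0) ->
  1 <= 2 * (M * Num.sqrt nu).
Proof.
move=> d0 [B UB] nU Ux Gx; rewrite leNgt; apply/negP => H.
have M0 := scc_gt0 scc; have n0 : 0 <= Num.sqrt nu by exact: sqrtr_ge0.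
have dbl w : U w -> U (x + 2 *: (w - x)).
  move=> Uw.
  have l1 : M * Num.sqrt nu < 1 by lra.
  have g1 h : `|dotv (G w + 0) h| <= Num.sqrt nu * mnorm (Hs w) h.
    by rewrite addr0; exact: Gnu.
  have g2 h : dotv (G x + 0) h = 0 by rewrite addr0.
  have := newton_decrement_dist scc Uw Ux n0 l1 g1 g2.
  rewrite mnormBC => l2.
  have -> : x + 2 *: (w - x) = w + (w - x).
    by rewrite scaler_nat mulr2n addrA [x + (w - x)]addrC subrK.
  apply: (scc_dikin scc Uw); move: (mnorm _ _) l2 => a l2.
  have : M * (a * (1 - M * Num.sqrt nu)) < 1 * (1 - M * Num.sqrt nu).
    by rewrite (le_lt_trans (ler_wpM2l (ltW M0) l2))//; lra.
  by rewrite mulrA ltr_pM2r//; lra.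
have dblk k w : U w -> U (x + (2 ^+ k) *: (w - x)).
  elim: k w => [|k IHk] w Uw; first by rewrite expr0 scale1r addrC subrK.
  have := IHk _ (dbl w Uw); congr U.
  by rewrite addrAC subrr add0r scalerA exprSr.
have [h h0] : exists h : 'cV[R]_d, h != 0.
  exists (const_mx 1); apply/eqP => /matrixP/(_ (Ordinal d0) ord0).
  by rewrite !mxE => /eqP; rewrite oner_eq0.
have [e e0 He] : exists2 e : R, 0 < e & U (x + e *: h).
  have nU0 : nbhs (x + 0 *: h) U by rewrite scale0r addr0.
  have /nbhs_ballP[e /= e0 be] := cvg_line nU0.
  exists (e / 2); first by rewrite divr_gt0.
  apply: be; rewrite /ball/= sub0r normrN gtr0_norm ?divr_gt0//.
  by rewrite ltr_pdivrMr// ltr_pMr// ltr1n.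
have eh : 0 < e * `|h| by rewrite mulr_gt0// normr_gt0.
(* The exponent is such that [2^(k+1) e |h|] exceeds [B + |x|], against the boundedness of [U]. *)
pose k := Num.truncn ((B + `|x|) / (e * `|h|)).
have kB : (B + `|x|) / (e * `|h|) < k.+1%:R by exact: truncnS_gt.
have := UB _ (dblk k.+1 _ He).
rewrite (addrAC x) subrr add0r scalerA.
have := lerB_normD (2 ^+ k.+1 * e *: h) x; rewrite [_ + x]addrC => l1 l2.
have : `|2 ^+ k.+1 * e *: h| <= B + `|x| by rewrite -lerBlDr (le_trans l1 l2).
rewrite normrZ normrM gtr0_norm ?exprn_gt0// (gtr0_norm e0) -mulrA.
rewrite -ler_pdivlMr// leNgt => /negP; apply; apply: (lt_le_trans kB).
by rewrite -natrX ler_nat ltnW// ltn_expl.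
Qed.

End Barrier.

(** * Preconditioned Newton steps *)

Section NewtonEstimates.
Context {R : realType}.
Implicit Types (p q r a n M : R).

Lemma local_radius a n M : 0 < M -> a <= 51 / 50 * n -> M * n <= 29 / 1000 ->
  a <= 3 / (100 * M) /\ M * a < 1.
Proof.
move=> M0 an Mn.
have Ma : M * a <= 3 / 100 by have := ler_wpM2l (ltW M0) an; lra.
split; last by lra.
by rewrite invfM mulrA ler_pdivlMr// mulrC.
Qed.

Lemma radius_norm p q : 0 <= p -> 99 / 100 * p <= q -> p <= (51 / 50) ^+ 2 * q.
Proof. by lra. Qed.

Lemma radius_dikin M : 0 < M -> M * (3 / (100 * M)) = 3 / 100 /\
  M * (3 / (100 * M)) <= 1 / 30.
Proof.
move=> M0; have -> : M * (3 / (100 * M)) = 3 / 100 by field; rewrite gt_eqF.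
by split=> //; lra.
Qed.

Lemma two_sided p q r : 0 <= p -> 0 <= q -> 0 <= r ->
  99 / 100 * p <= r -> r <= 101 / 100 * p ->
  (1 - 15 / 2 * (3 / 100)) * q <= p -> (1 - 15 / 2 * (3 / 100)) * p <= q ->
  2 / 3 * r <= q <= 4 / 3 * r.
Proof. by move=> *; apply/andP; split; lra. Qed.

Lemma two_sided_norm p q : 0 <= p -> 0 <= q -> 2 / 3 * p <= q <= 4 / 3 * p ->
  q <= (7 / 6) ^+ 2 * p /\ p <= (5 / 4) ^+ 2 * q.
Proof. by move=> p0 q0 /andP[l1 l2]; split; lra. Qed.

Lemma two_sided_diff p q : 2 / 3 * p <= q <= 4 / 3 * p -> `|p - q| <= 1 / 3 * p.
Proof. by move=> /andP[l1 l2]; rewrite ler_norml; apply/andP; split; lra. Qed.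

End NewtonEstimates.

Section PreconditionedNewton.
Context {R : realType} {d : nat} (U : set 'cV[R]_d) (f : 'cV[R]_d -> R).
Context (G : 'cV[R]_d -> 'cV[R]_d) (Hs : 'cV[R]_d -> 'M[R]_d) (M : R).
Hypothesis scc : sc_calculus U f G Hs M.
Implicit Types (x y w h u g s : 'cV[R]_d) (H Hinv : 'M[R]_d) (t eps : R).

Let M_gt0 : 0 < M. Proof. exact: scc_gt0 scc. Qed.

Record hess_approx u H Hinv : Prop := HessApprox {
  ha_in : U u;
  ha_pdef : pdef H;
  ha_inv : H *m Hinv = 1%:M;
  ha_ge : forall h, 99 / 100 * dotv h (Hs u *m h) <= dotv h (H *m h);
  ha_le : forall h, dotv h (H *m h) <= 101 / 100 * dotv h (Hs u *m h)
}.

Section Around.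
Variables (u : 'cV[R]_d) (H Hinv : 'M[R]_d).
Hypothesis ha : hess_approx u H Hinv.

Let psdH : psd H := pdef_psd (ha_pdef ha).
Let sH : H^T = H := psdH.1.

(** A radius [29 / (1000 M)] in the norm of [H] is at most [3 / (100 M)] in that of [Hs u], where
    stability has the factor [1 - 15/2 * 3/100 = 31/40]. Together with the one-percent accuracy of
    [H] this gives [2/3] and [4/3]. *)
Lemma near_hess x : M * mnorm H (x - u) <= 29 / 1000 ->
  U x /\ forall h, 2 / 3 * dotv h (H *m h) <= dotv h (Hs x *m h)
                     <= 4 / 3 * dotv h (H *m h).
Proof.
move=> xu; have Uu := ha_in ha.
have psdu := pdef_psd (scc_pdef scc Uu).
have Nu : mnorm (Hs u) (x - u) <= 51 / 50 * mnorm H (x - u).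
  apply: ler_mnorm; first by rewrite divr_ge0.
  exact: radius_norm (psdu.2 _) (ha_ge ha (x - u)).
have [Nr Mr] := local_radius M_gt0 Nu xu.
have Ux : U x by have := scc_dikin scc Uu Mr; rewrite addrC subrK.
split=> // h.
have r0 : 0 < 3 / (100 * M) by rewrite divr_gt0 ?mulr_gt0.
have [Mr' Mr30] := radius_dikin M_gt0.
have [] := hessian_stability scc h Uu r0 Nr Mr30; rewrite Mr'.
apply: two_sided (psdu.2 h) _ (psdH.2 h) (ha_ge ha h) (ha_le ha h).
exact: (pdef_psd (scc_pdef scc Ux)).2.
Qed.

Lemma near_hess_norm x h : M * mnorm H (x - u) <= 29 / 1000 ->
  mnorm (Hs x) h <= 7 / 6 * mnorm H h /\ mnorm H h <= 5 / 4 * mnorm (Hs x) h.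
Proof.
move=> /near_hess[Ux /(_ h) Hx].
have px := (pdef_psd (scc_pdef scc Ux)).2 h.
have [l1 l2] := two_sided_norm (psdH.2 h) px Hx.
by split; apply: ler_mnorm; rewrite ?divr_ge0.
Qed.

Lemma ball_convex x y t : 0 <= t <= 1 ->
  M * mnorm H (x - u) <= 29 / 1000 -> M * mnorm H (y - u) <= 29 / 1000 ->
  M * mnorm H (x + t *: (y - x) - u) <= 29 / 1000.
Proof.
move=> /andP[t0 t1] xu yu.
have -> : x + t *: (y - x) - u = (1 - t) *: (x - u) + t *: (y - u).
  by apply/colP => i; rewrite !mxE; ring.
apply: (le_trans (ler_wpM2l (ltW M_gt0) (ler_mnormD _ _ psdH))).
rewrite !mnormZ (ger0_norm t0) ger0_norm ?subr_ge0// mulrDr !(mulrCA M).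
have t1' : 0 <= 1 - t by rewrite subr_ge0.
by have := ler_wpM2l t0 yu; have := ler_wpM2l t1' xu; lra.
Qed.

(** Only the scalar function obtained by pairing with [z] is expanded, so the intermediate point
    [xi] depends on [z]. *)
Lemma gradient_mean_value x y z :
  M * mnorm H (x - u) <= 29 / 1000 -> M * mnorm H (y - u) <= 29 / 1000 ->
  exists2 xi, M * mnorm H (xi - u) <= 29 / 1000 &
    dotv (G y) z - dotv (G x) z = dotv (y - x) (Hs xi *m z).
Proof.
move=> xu yu.
have d1 t (t01 : 0 <= t <= 1) :=
  scc_derive1 scc z (near_hess (ball_convex t01 xu yu)).1.
have [t t01] := ex_mean_value ler01 d1.
rewrite scale1r scale0r addr0 subr0 mulr1 [x + _]addrC subrK => e.
by exists (x + t *: (y - x)) => //; exact: ball_convex.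
Qed.

(* The step maps [w - y] to [H^-1 (H - Hs xi) (w - y)] for a mean value [xi], up
   to the oracle error, and [H - Hs xi] lies between [- 1/3 H] and [1/3 H]. *)
Lemma newton_step_contracts y w s g eps : 0 <= eps ->
  M * mnorm H (y - u) <= 29 / 1000 -> M * mnorm H (w - u) <= 29 / 1000 ->
  (forall h, dotv (G y + s) h = 0) ->
  (forall h, `|dotv (g - G w) h| <= eps * mnorm (Hs w) h) ->
  mnorm H (w - Hinv *m (g + s) - y) <= 1 / 3 * mnorm H (w - y) + 7 / 6 * eps.
Proof.
move=> e0 yu wu Gy gw.
set z := w - Hinv *m (g + s) - y.
(* The mean value is taken in the direction of the new error [z] itself, which yields an identity
   for the squared norm of [z]. *)
have [xi xiu e] := gradient_mean_value z yu wu.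
have [Uxi Hxi] := near_hess xiu.
have sxi : (Hs xi)^T = Hs xi := (scc_pdef scc Uxi).1.
have Hz : H *m z = H *m (w - y) - (g + s).
  by rewrite /z addrAC mulmxBr mulmxA (ha_inv ha) mul1mx.
have zz : mnorm H z ^+ 2 = dotv z ((H - Hs xi) *m (w - y)) - dotv (g - G w) z.
  rewrite sqr_mnorm// Hz mulmxBl !(dotvBr z (H *m _)) (dotv_mulmx_sym _ _ sxi) -e.
  have := Gy z; rewrite dotvDl dotvBl dotvDr (dotvC z g) (dotvC z s); lra.
have b1 : `|dotv z ((H - Hs xi) *m (w - y))| <=
    1 / 3 * (mnorm H z * mnorm H (w - y)).
  apply: mnorm_bilin_le; [by rewrite divr_ge0 | by rewrite linearB/= sH sxi | exact: ha_pdef ha |].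
  by move=> h; rewrite mulmxBl dotvBr; exact: two_sided_diff.
have b2 : `|dotv (g - G w) z| <= 7 / 6 * eps * mnorm H z.
  apply: (le_trans (gw z)); rewrite mulrAC mulrC.
  by apply: ler_wpM2r => //; exact: (near_hess_norm z wu).1.
have := mnorm_ge0 H z; rewrite le_eqVlt => /predU1P[<-|z0].
  by rewrite addr_ge0// mulr_ge0// ?mnorm_ge0//; lra.
rewrite -(ler_pM2l z0) -expr2 zz.
move: b1 b2; rewrite !ler_norml => /andP[_ b1] /andP[b2 _].
by move: b1 b2; move: (dotv _ _) (dotv _ _) (mnorm _ _) (mnorm _ _) => p q a b; lra.
Qed.

End Around.

End PreconditionedNewton.

(** * Rounds of BARONS *)

Section RoundEstimates.
Context {R : realType}.
Implicit Types (M eps e lam n D a : R).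

Lemma round_radius M eps e : 0 < M -> M * eps <= 1 / 1000 / 20 -> M * e <= 1 / 1000 ->
  M * (4 * eps + e) <= 3 / 50 / 50 /\ M * (4 * eps + e) < 1.
Proof. by move=> M0 h1 h2; split; lra. Qed.

Lemma round_decrement M lam n : 0 <= lam -> M * lam <= 3 / 50 / 50 ->
  0 <= n -> n * (1 - M * lam) <= lam -> n <= 51 / 50 * lam.
Proof.
move=> l0 Ml n0 H.
have : n * (1 - 3 / 50 / 50) <= n * (1 - M * lam) by rewrite ler_wpM2l//; lra.
lra.
Qed.

Lemma round_dist M lam n D : 0 < M -> M * lam <= 3 / 50 / 50 -> n <= 51 / 50 * lam ->
  0 <= lam -> D <= 5 / 4 * n -> D <= 13 / 10 * lam /\ M * D <= 1 / 600.
Proof.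
move=> M0 Ml nl l0 Dn; have D1 : D <= 13 / 10 * lam by lra.
by split=> //; have := ler_wpM2l (ltW M0) D1; lra.
Qed.

(** A round has [m - 1] Newton steps; with the last factor [1/3] missing, the remainder is
    [3 eps M D <= eps / 200], and [1/200 + 7/4 <= 2]. *)
Lemma round_final M eps D a k : 0 < M -> 0 <= eps -> 0 <= D -> M * D <= 1 / 600 ->
  (1 / 3) ^+ k.+1 <= eps * M -> a <= (1 / 3) ^+ k * D + 7 / 4 * eps ->
  a <= 2 * eps.
Proof.
move=> M0 e0 D0 MD; rewrite exprS => Hk Ha.
have Hk' : (1 / 3) ^+ k <= 3 * eps * M by lra.
have := ler_wpM2r D0 Hk'; have := ler_wpM2l e0 MD; lra.
Qed.

(** The radius [29/1000] leaves room for [1/41] from the anchor, twice [1/600] for distances to [y],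
    and the oracle errors. *)
Lemma round_ball M eps D a n : 0 < M -> 0 <= eps -> M * eps <= 1 / 1000 / 20 ->
  M * n <= 1 / 41 -> M * D <= 1 / 600 -> a <= D + n ->
  [/\ M * a + M * (D + 7 / 4 * eps) <= 29 / 1000, M * a <= 29 / 1000
    & M * (2 * eps + a) <= 29 / 1000].
Proof.
move=> M0 e0 Me Mn MD aDn; have Ma := ler_wpM2l (ltW M0) aDn.
by split; lra.
Qed.

(** In use, [p] and [q] are local norms at a mean value point. The constant
    [2 * 7/6 * 7/6 * 5/4 = 245/72] is below 4, which restores the gradient bound [4 eps]. *)
Lemma round_gradient eps (p q a c n : R) : 0 <= eps -> 0 <= p -> 0 <= q -> 0 <= n ->
  p <= 7 / 6 * a -> q <= 7 / 6 * c -> c <= 5 / 4 * n -> a <= 2 * eps ->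
  p * q <= 4 * eps * n.
Proof.
move=> e0 p0 q0 n0 pa qc cn ae.
have p1 : p <= 7 / 3 * eps by lra.
have q1 : q <= 35 / 24 * n by lra.
have := ler_pM p0 q0 p1 q1; have := mulr_ge0 e0 n0; lra.
Qed.

Lemma round_move eps e (a D : R) : 0 <= eps -> 0 <= e ->
  a <= 2 * eps -> D <= 13 / 10 * (4 * eps + e) -> a + D <= 2 * e + 8 * eps.
Proof. by lra. Qed.

(** Amortization: a Hessian call adds [1/41] to the potential and resets to zero an anchor distance
    that exceeded [1 / (41 M)]. *)
Lemma round_hess_calls M (h a n c : R) : 0 < M -> 1 / (41 * M) < n -> n <= a + c ->
  (h + 1) / 41 + M * 0 <= h / 41 + M * a + M * c.
Proof.
move=> M0; rewrite ltr_pdivrMr ?mulr_gt0// => n1 nac.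
by have := ler_wpM2l (ltW M0) nac; lra.
Qed.

Lemma round_near M (n : R) : 0 < M -> n <= 1 / (41 * M) -> M * n <= 1 / 41.
Proof. by move=> M0; rewrite ler_pdivlMr ?mulr_gt0//; lra. Qed.

Lemma potential_step (F A c p q s E k v : R) : c * (p - q) <= E ->
  F + A - k * E <= v + s -> F + (A + c * p) - (k + 1) * E <= v + (s + c * q).
Proof. by lra. Qed.

End RoundEstimates.

Lemma newton_flopsE (d n a : nat) :
  (d + (2 * d * d + (d + a)) + n * (2 * d * d + 2 * d) =
   a + n.+1 * (2 * d * d + 2 * d))%N.
Proof.
by rewrite mulSn; lia.
Qed.

(** The summands follow a round in order; the final 3 pays for the threshold [1 / (41 M)] and the
    comparison. *)
Definition round_flops (d m : nat) : nat :=
  d + d + m.-1 * (2 * d * d + 2 * d) + d + (2 * d * d + 2 * d + 1) + 3.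

Lemma round_flopsE (d m a : nat) :
  (1 + (2 + (2 * d * d + 2 * d + 1 + (d + (d + (d + a) +
    m.-1 * (2 * d * d + 2 * d))))) = a + round_flops d m)%N.
Proof. by rewrite /round_flops; lia. Qed.

Section Rounds.
Context {R : realType} {d : nat} (U : set 'cV[R]_d) (f : 'cV[R]_d -> R).
Context (G : 'cV[R]_d -> 'cV[R]_d) (Hs : 'cV[R]_d -> 'M[R]_d) (M : R).
Hypothesis scc : sc_calculus U f G Hs M.
Context (eta eps b : R) (m : nat).
Context (ograd : nat -> 'cV[R]_d -> 'cV[R]_d).
Context (ohess : nat -> 'cV[R]_d -> 'M[R]_d * 'M[R]_d).
Context (g : nat -> 'cV[R]_d).
Implicit Types (x y w h u s : 'cV[R]_d) (H Hinv : 'M[R]_d) (st : @barons_state R d).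
Implicit Types (r : usage).

Hypotheses (eta_ge0 : 0 <= eta) (eps_ge0 : 0 <= eps) (b_ge0 : 0 <= b).
Hypotheses (M_eps : M * eps <= 1 / 1000 / 20) (M_eta : M * (eta * b) <= 1 / 1000).
Hypotheses (m_gt0 : (0 < m)%N) (m_eps : (1 / 3) ^+ m <= eps * M).
Hypothesis gradP : forall n w h, U w ->
  `|dotv (ograd n w - G w) h| <= eps * mnorm (Hs w) h.
Hypothesis hessP : forall n w, U w ->
  hess_approx U Hs w (ohess n w).1 (ohess n w).2.
Hypothesis minP : forall s, exists y, [/\ U y,
  forall x, U x -> f y + dotv s y <= f x + dotv s x
  & forall h, dotv (G y + s) h = 0].

Let M_gt0 : 0 < M. Proof. exact: scc_gt0 scc. Qed.

(** The error recursion [a -> a/3 + 7/6 eps] has the fixed point [7/4 eps]; [D] bounds the excess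
    over it and shrinks by a factor 3 per step. The radius hypothesis keeps every iterate in the
    ball where [H] is accurate. *)
Lemma iterate_newton u H Hinv s y n w r D : hess_approx U Hs u H Hinv ->
  (forall h, dotv (G y + s) h = 0) -> 0 <= D ->
  M * mnorm H (y - u) + M * (D + 7 / 4 * eps) <= 29 / 1000 ->
  mnorm H (w - y) <= D + 7 / 4 * eps ->
  let: (w', r') := iterate n (newton_step ograd s Hinv) w r in
  [/\ mnorm H (w' - y) <= (1 / 3) ^+ n * D + 7 / 4 * eps,
      grad_calls r' = (grad_calls r + n)%N, hess_calls r' = hess_calls r
    & flops r' = (flops r + n * (2 * d * d + 2 * d))%N].
Proof.
move=> ha Gy; elim: n w r D => [|n IHn] w r D D0 yu wy.
  by rewrite /= expr0 mul1r !addn0.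
have psdH := pdef_psd (ha_pdef ha).
have Mn a : 0 <= M * mnorm H a := mulr_ge0 (ltW M_gt0) (mnorm_ge0 H a).
have yu' : M * mnorm H (y - u) <= 29 / 1000.
  apply: le_trans yu; rewrite lerDl (mulr_ge0 (ltW M_gt0))// addr_ge0//.
  by rewrite mulr_ge0.
have wu : M * mnorm H (w - u) <= 29 / 1000.
  apply: le_trans yu; rewrite [leRHS]addrC -mulrDr; apply: (ler_wpM2l (ltW M_gt0)).
  have -> : w - u = (w - y) + (y - u) by rewrite addrA subrK.
  by apply: (le_trans (ler_mnormD _ _ psdH)); rewrite lerD2r.
have Uw := (near_hess scc ha wu).1.
have st := newton_step_contracts scc ha eps_ge0 yu' wu Gy 
  (fun h => @gradP (grad_calls r) w h Uw).
rewrite -[iterate _ _ _ _]/(iterate n (newton_step ograd s Hinv)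
  (w - Hinv *m (ograd (grad_calls r) w + s))
  (Usage (grad_calls r).+1 (hess_calls r) (d + (2 * d * d + (d + flops r))))).
have D3 : 0 <= D / 3 by rewrite divr_ge0.
have := IHn (w - Hinv *m (ograd (grad_calls r) w + s))
  (Usage (grad_calls r).+1 (hess_calls r) (d + (2 * d * d + (d + flops r)))) _ D3.
case: iterate => w' r' /=.
have yu3 : M * mnorm H (y - u) + M * (D / 3 + 7 / 4 * eps) <= 29 / 1000.
  apply: le_trans yu; rewrite lerD2l (ler_pM2l M_gt0) lerD2r.
  by rewrite ler_pdivrMr// ler_peMr// ler1n.
have wy3 : mnorm H (w - Hinv *m (ograd (grad_calls r) w + s) - y) <= D / 3 + 7 / 4 * eps.
  by move: st wy; move: (mnorm _ _) (mnorm _ _) => p q; lra.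
move=> /(_ yu3 wy3)[h1 -> -> ->]; split=> //.
- suff <- : (1 / 3) ^+ n * (D / 3) = (1 / 3) ^+ n.+1 * D by [].
  by rewrite exprSr; field.
- by rewrite addSnnS.
- exact: newton_flopsE.
Qed.

Record barons_inv st : Prop := BaronsInv {
  bi_approx : hess_approx U Hs (st_u st) (st_H st) (st_Hinv st);
  bi_near : M * mnorm (st_H st) (st_w st - st_u st) <= 1 / 41;
  bi_grad : forall h,
    `|dotv (G (st_w st) + st_s st) h| <= 4 * eps * mnorm (Hs (st_w st)) h
}.

Lemma inv_radius (a : R) : M * a <= 1 / 41 -> M * a <= 29 / 1000.
Proof. by lra. Qed.

Lemma barons_inv_in st : barons_inv st -> U (st_w st).
Proof. by case=> ha near _; exact: (near_hess scc ha (inv_radius near)).1. Qed.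

Definition anchor_dist st : R := mnorm (st_H st) (st_w st - st_u st).

(** Here [y] minimizes the potential tilted by the new sum. The new subgradient raises the gradient
    bound to [lam], so [w] is within order [lam] of [y]; the Newton steps bring the distance down to
    [2 eps], which restores the invariant. *)
Lemma barons_roundP t st r : barons_inv st ->
  (forall h, `|dotv (g t) h| <= b * mnorm (Hs (st_w st)) h) ->
  let: (st', r') := barons_round eta M m ograd ohess g t st r in
  [/\ barons_inv st',
      st_s st' = st_s st + eta *: g t,
      exists y, [/\ U y,
        forall x, U x -> f y + dotv (st_s st') y <= f x + dotv (st_s st') x
        & `|dotv (g t) (st_w st - y)| <= b * (51 / 50 * (4 * eps + eta * b))],
      (hess_calls r')%:R / 41 + M * anchor_dist st' <=
        (hess_calls r)%:R / 41 + M * anchor_dist st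
        + M * (2 * (eta * b) + 8 * eps)
    & grad_calls r' = (grad_calls r + m.-1)%N /\
      flops r' = (flops r + round_flops d m)%N].
Proof.
move=> [ha near gr] gb.
case: st ha near gr gb => s w u H Hinv /= ha near gr gb.
set s' := s + eta *: g t.
have [y [Uy ymin Gy]] := minP s'.
set lam := 4 * eps + eta * b.
have eb0 : 0 <= eta * b := mulr_ge0 eta_ge0 b_ge0.
have lam0 : 0 <= lam by rewrite addr_ge0// mulr_ge0.
have [Mlam Mlam1] := round_radius M_gt0 M_eps M_eta.
have psdH := pdef_psd (ha_pdef ha).
have wu := inv_radius near.
have Uw := (near_hess scc ha wu).1.
have gw h : `|dotv (G w + s') h| <= lam * mnorm (Hs w) h.
  rewrite /s' addrA dotvDl dotvZl (le_trans (ler_normD _ _))// mulrDl.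
  apply: lerD; first exact: gr.
  by rewrite normrM (ger0_norm eta_ge0) -mulrA (ler_wpM2l eta_ge0).
have n0 := mnorm_ge0 (Hs w) (y - w).
have dec := round_decrement lam0 Mlam n0
  (newton_decrement_dist scc Uw Uy lam0 Mlam1 gw Gy).
have Dn : mnorm H (w - y) <= 5 / 4 * mnorm (Hs w) (y - w).
  by rewrite mnormBC; exact: (near_hess_norm scc ha (y - w) wu).2.
have [Dlam MD] := round_dist M_gt0 Mlam dec lam0 Dn.
have D0 := mnorm_ge0 H (w - y).
have yu0 : mnorm H (y - u) <= mnorm H (w - y) + mnorm H (w - u).
  have -> : y - u = (y - w) + (w - u) by rewrite addrA subrK.
  by rewrite (mnormBC _ w y); exact: ler_mnormD.
have [yu yu' w'b] := round_ball M_gt0 eps_ge0 M_eps near MD yu0.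
have wy : mnorm H (w - y) <= mnorm H (w - y) + 7 / 4 * eps by rewrite lerDl mulr_ge0.
rewrite /barons_round /bind /vscale /vadd /vsub /vnorm /pay /= -/s'.
set r1 := Usage _ _ _.
have := iterate_newton m.-1 r1 ha Gy D0 yu wy.
case: iterate => w' r2 [w'y gc hc fl].
have m1 : (1 / 3) ^+ m.-1.+1 <= eps * M by rewrite prednK.
have {}w'y := round_final M_gt0 eps_ge0 D0 MD m1 w'y.
have w'u : M * mnorm H (w' - u) <= 29 / 1000.
  have -> : w' - u = (w' - y) + (y - u) by rewrite addrA subrK.
  apply: le_trans w'b; apply: (ler_wpM2l (ltW M_gt0)).
  by apply: (le_trans (ler_mnormD _ _ psdH)); rewrite lerD2r.
have Uw' := (near_hess scc ha w'u).1.
(* The tilted gradient vanishes at [y], so its pairing with [h] at [w'] is that of a Hessian at some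
   [xi] applied to [h] with [w' - y]. *)
have gr' h : `|dotv (G w' + s') h| <= 4 * eps * mnorm (Hs w') h.
  have [xi xiu e] := gradient_mean_value scc ha h yu' w'u.
  have -> : dotv (G w' + s') h = dotv (w' - y) (Hs xi *m h).
    by rewrite -e dotvDl; have := Gy h; rewrite dotvDl; lra.
  have pxi := pdef_psd (scc_pdef scc (near_hess scc ha xiu).1).
  apply: (le_trans (mnorm_cauchy_schwarz _ _ pxi)).
  have [l1 _] := near_hess_norm scc ha (w' - y) xiu.
  have [l2 _] := near_hess_norm scc ha h xiu.
  have [_ l3] := near_hess_norm scc ha h w'u.
  apply: round_gradient l1 l2 l3 w'y; by rewrite ?mnorm_ge0.
have move_w : mnorm H (w' - w) <= 2 * (eta * b) + 8 * eps.
  have -> : w' - w = (w' - y) - (w - y) by rewrite opprB addrA subrK.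
  apply: (le_trans (ler_mnormD _ _ psdH)); rewrite mnormN.
  exact: round_move eps_ge0 eb0 w'y Dlam.
have dw : `|dotv (g t) (w - y)| <= b * (51 / 50 * lam).
  apply: (le_trans (gb _)); apply: (ler_wpM2l b_ge0).
  by rewrite mnormBC.
have dist' : mnorm H (w' - u) <= mnorm H (w - u) + (2 * (eta * b) + 8 * eps).
  have -> : w' - u = (w' - w) + (w - u) by rewrite addrA subrK.
  by apply: (le_trans (ler_mnormD _ _ psdH)); rewrite addrC lerD2l.
(* Without an update the anchor distance grows by at most the move of the iterate; with one it
   restarts at zero. *)
case: ifPn => close /=.
  split=> //; first by split=> //; exact: round_near.
  - by exists y.
  - by rewrite hc /anchor_dist /= -addrA lerD2l -mulrDr (ler_pM2l M_gt0).
  - by rewrite gc fl; split=> //; exact: round_flopsE.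
rewrite -ltNge in close.
split=> //.
- by split=> //=; [exact: hessP | rewrite subrr mnorm0 mulr0 divr_ge0].
- by exists y.
- rewrite hc /anchor_dist /= subrr mnorm0 -natr1.
  exact: round_hess_calls M_gt0 close dist'.
- by rewrite gc fl; split=> //; exact: round_flopsE.
Qed.

Context (wstar : 'cV[R]_d) (T : nat).
Hypotheses (Uwstar : U wstar) (wstar_min : forall x, U x -> f wstar <= f x).
Hypothesis Gwstar : forall h, dotv (G wstar) h = 0.

Let play := barons_play eta M m wstar ograd ohess g.

(** The premise [U (play t)] is discharged by the invariant inside the induction. *)
Hypothesis gP : forall t, (1 <= t <= T)%N -> U (play t) -> forall h,
  `|dotv (g t) h| <= b * mnorm (Hs (play t)) h.

(* The third clause is the "be the leader" argument: the potential on its right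
   is smallest at the exact iterate, whose distance to [play t] is controlled. *)
Lemma baronsP t : (t <= T)%N ->
  let: (st, r) := barons eta M m wstar ograd ohess g t no_usage in
  [/\ barons_inv st, st_s st = \sum_(1 <= i < t.+1) eta *: g i,
      forall x, U x -> f wstar + \sum_(1 <= i < t.+1) eta * dotv (g i) (play i)
        - t%:R * (eta * (b * (51 / 50 * (4 * eps + eta * b))))
        <= f x + dotv (st_s st) x,
      (hess_calls r)%:R / 41 + M * anchor_dist st <=
        1 / 41 + t%:R * (M * (2 * (eta * b) + 8 * eps))
    & grad_calls r = (t * m.-1)%N /\ flops r = (t * round_flops d m)%N].
Proof.
elim: t => [_|t IHt tT] /=.
  split.
  - split=> /=; first exact: hessP.
    + by rewrite subrr mnorm0 mulr0 divr_ge0.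
    + by move=> h; rewrite addr0 Gwstar normr0 !mulr_ge0 ?mnorm_ge0.
  - by rewrite big_geq.
  - move=> x Ux; rewrite big_geq//= mul0r subr0 addr0 dotvC dotv0r addr0.
    exact: wstar_min.
  - by rewrite /anchor_dist /= subrr mnorm0 mulr0 mul0r.
  - by rewrite !mul0n.
have playE : play t.+1 = st_w (barons eta M m wstar ograd ohess g t no_usage).1.
  by [].
have := IHt (ltnW tT); rewrite /bind.
case: (barons eta M m wstar ograd ohess g t no_usage) playE => st r /= playE.
move=> [inv sE pot hc [gc fl]].
have gt h : `|dotv (g t.+1) h| <= b * mnorm (Hs (st_w st)) h.
  by rewrite -playE; apply: gP; [rewrite tT | rewrite playE; exact: barons_inv_in].
have := barons_roundP r inv gt.
case: barons_round => st' r' [inv' sE' [y [Uy ymin dy]] hc' [gc' fl']].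
split=> //.
- by rewrite sE' sE [RHS]big_nat_recr.
(* The new leader [y] minimizes the right side, so the induction hypothesis is applied at [y]; the
   gap between [y] and [play t.+1] contributes the error [E]. *)
- move=> x Ux; apply: le_trans (ymin x Ux).
  have := pot y Uy; rewrite sE' dotvDl dotvZl [in X in _ -> X]big_nat_recr//= playE.
  have := ler_wpM2l eta_ge0 (le_trans (ler_norm _) dy).
  rewrite dotvBr -[t.+1%:R]natr1; move: (eta * (b * _)) => E.
  exact: potential_step.
- apply: (le_trans hc'); rewrite -[t.+1%:R]natr1 (mulrDl t%:R 1) [1 * (M * _)]mul1r.
  by rewrite [leRHS]addrA lerD2r.
- by rewrite gc' fl' gc fl !mulSnr.
Qed.

Lemma barons_linear_regret x : U x ->
  eta * \sum_(1 <= i < T.+1) dotv (g i) (play i - x) <=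
    f x - f wstar + T%:R * (eta * (b * (51 / 50 * (4 * eps + eta * b)))).
Proof.
move=> Ux; have := baronsP (leqnn T).
case: barons => st r [_ sE /(_ x Ux) + _ _]; rewrite sE dotvC dotv_sumr.
move: (T%:R * _) => E H.
suff -> : eta * \sum_(1 <= i < T.+1) dotv (g i) (play i - x) =
    \sum_(1 <= i < T.+1) eta * dotv (g i) (play i) -
    \sum_(1 <= i < T.+1) dotv x (eta *: g i) by lra.
rewrite mulr_sumr -sumrB; apply: eq_bigr => i _.
by rewrite dotvBr mulrBr dotvZr (dotvC x).
Qed.

End Rounds.

(** * Oracles and rates *)

Section Oracles.
Context {R : realType} {d : nat}.
Implicit Types (D H Hinv : 'M[R]_d).

(** Nondegeneracy of the Hessian comes from the oracle answer: adding the Loewner bounds makes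
    [2 a D] symmetric and semidefinite, invertibility makes [H] definite, and the upper bound
    carries this over to [D]. *)
Lemma loewner_sandwich D H Hinv (a : R) : 0 < a -> a < 1 -> H *m Hinv = 1%:M ->
  loewner_le ((1 - a) *: D) H -> loewner_le H ((1 + a) *: D) ->
  [/\ pdef D, pdef H,
    forall h, (1 - a) * dotv h (D *m h) <= dotv h (H *m h)
    & forall h, dotv h (H *m h) <= (1 + a) * dotv h (D *m h)].
Proof.
move=> a0 a1 HH lo hi.
have lo' h : (1 - a) * dotv h (D *m h) <= dotv h (H *m h).
  by have := loewner_leP lo h; rewrite -scalemxAl dotvZr.
have hi' h : dotv h (H *m h) <= (1 + a) * dotv h (D *m h).
  by have := loewner_leP hi h; rewrite -scalemxAl dotvZr.
have D0 h : 0 <= dotv h (D *m h).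
  have : 0 <= (2 * a) * dotv h (D *m h) by have := lo' h; have := hi' h; lra.
  by rewrite pmulr_rge0// mulr_gt0.
have H0 h : 0 <= dotv h (H *m h).
  by apply: le_trans (lo' h); rewrite mulr_ge0// subr_ge0 ltW.
have sD : D^T = D.
  have [/matrixP e1 _] := lo; have [/matrixP e2 _] := hi.
  apply/matrixP => i j; have := e1 i j; have := e2 i j; rewrite !mxE => l2 l1.
  by apply: (@mulfI _ (2 * a)); [rewrite mulf_neq0// gt_eqF | lra].
have sH : H^T = H.
  have [/matrixP e _] := hi; move/matrixP: sD => sD.
  by apply/matrixP => i j; have := e i j; have := sD i j; rewrite !mxE => -> /addrI/oppr_inj.
have uH : H \in unitmx by case: (mulmx1_unit HH).
have pH : pdef H by apply: psd_unit_pdef.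
split=> //; split=> // x x0; have Hx := pH.2 x x0.
have : 0 < (1 + a) * dotv x (D *m x) by exact: lt_le_trans (hi' x).
by rewrite pmulr_rgt0// addr_gt0.
Qed.

End Oracles.

Section Rates.
Context {R : realType}.
Implicit Types (nu L b T M : R).

Lemma rate_step nu L b T : 0 <= nu * T * L -> 0 < b -> 0 < T ->
  Num.sqrt (nu * L / (b ^+ 2 * T)) * b * T = Num.sqrt (nu * T * L).
Proof.
move=> n0 b0 T0.
have -> : nu * L / (b ^+ 2 * T) = (Num.sqrt (nu * T * L) / (b * T)) ^+ 2.
  by rewrite expr_div_n sqr_sqrtr//; field; rewrite !gt_eqF.
rewrite sqrtr_sqr ger0_norm; first by rewrite -mulrA divfK// gt_eqF// mulr_gt0.
by rewrite divr_ge0 ?sqrtr_ge0// ltW// mulr_gt0.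
Qed.

Lemma rate_error nu T : 0 <= nu * T -> 0 < T ->
  Num.sqrt (nu / T) * T = Num.sqrt (nu * T).
Proof.
move=> n0 T0.
have -> : nu / T = (Num.sqrt (nu * T) / T) ^+ 2.
  by rewrite expr_div_n sqr_sqrtr//; field; rewrite gt_eqF.
by rewrite sqrtr_sqr ger0_norm ?divfK ?gt_eqF// divr_ge0 ?sqrtr_ge0// ltW.
Qed.

(** This is where [c] bounded away from 1 enters: [L0] bounds [ln (1/c)] from below, so a term
    without logarithm is absorbed at the price of [1 / sqrt L0]. *)
Lemma sqrt_log_le nu T L L0 : 0 <= nu * T -> 0 < L0 -> L0 <= L ->
  Num.sqrt (nu * T) <= Num.sqrt (nu * T * L) / Num.sqrt L0.
Proof.
move=> n0 L00 LL; rewrite ler_pdivlMr ?sqrtr_gt0// -sqrtrM//.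
by rewrite ler_wsqrtr// ler_wpM2l.
Qed.

(** Since [1/3 <= e^(-2/3)], one gets [3^(-m) <= e^(-2m/3) <= x^(4/3) <= x]. *)
Lemma third_power_le (x : R) (m : nat) : 0 < x -> x <= 1 ->
  2 * ln (1 / x) <= m%:R -> (1 / 3) ^+ m <= x.
Proof.
move=> x0 x1 Hm.
have L0 : 0 <= ln (1 / x) by rewrite ln_ge0// div1r invf_ge1.
have e3 : 1 / 3 <= expR (- (2 / 3)) :> R.
  by apply: le_trans (expR_ge1Dx _); lra.
have -> : x = expR (- ln (1 / x)).
  by rewrite div1r lnV ?posrE// opprK lnK ?posrE.
apply: (@le_trans _ _ (expR (- (2 / 3)) ^+ m)).
  by rewrite lerXn2r ?nnegrE ?divr_ge0// expR_ge0.
by rewrite -expRM_natl ler_expR; lra.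
Qed.

(** [T / (nu M)] is [1 / (eps M)] divided by [eps], and [nu <= T] means [eps <= 1]. *)
Lemma ln_rate_le nu T M eps : 0 < nu -> nu <= T -> 0 < M ->
  eps = Num.sqrt (nu / T) -> ln (1 / (eps * M)) <= ln (T / (nu * M)).
Proof.
move=> n0 nT M0 eE.
have T0 : 0 < T := lt_le_trans n0 nT.
have nT0 : 0 < nu / T by rewrite divr_gt0.
have e0 : 0 < eps by rewrite eE sqrtr_gt0.
have e2 : eps ^+ 2 = nu / T by rewrite eE sqr_sqrtr// ltW.
have e1 : eps <= 1 by rewrite eE -[leRHS]sqrtr1 ler_wsqrtr// ler_pdivrMr// mul1r.
rewrite ler_ln ?posrE ?divr_gt0 ?mulr_gt0//.
have -> : T / (nu * M) = 1 / (eps * M) / eps.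
  have -> : 1 / (eps * M) / eps = 1 / (eps ^+ 2 * M).
    by field; rewrite !gt_eqF.
  by rewrite e2; field; rewrite !gt_eqF.
by rewrite ler_pdivlMr// ler_piMr// divr_ge0// ltW// mulr_gt0.
Qed.

(** As [eta b Q = nu L], dividing by [eta] leaves [b Q] times [1 + 51/50 + 4 * 51/50 * k], rounded
    up to [3 + 5 k]. *)
Lemma regret_rate (reg eta b eps nu L T Q k : R) : 0 < eta -> 0 < b -> 0 <= Q -> 0 <= k ->
  eta * b * T = Q -> eta * (b * Q) = nu * L -> eps * T <= Q * k ->
  eta * reg <= nu * L + T * (eta * (b * (51 / 50 * (4 * eps + eta * b)))) ->
  reg <= (3 + 5 * k) * (b * Q).
Proof.
move=> eta0 b0 Q0 k0 etaQ etabQ epsQ H.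
rewrite -(ler_pM2l eta0); apply: (le_trans H).
have -> : T * (eta * (b * (51 / 50 * (4 * eps + eta * b)))) =
  51 / 50 * (eta * b) * (4 * (eps * T) + eta * b * T) by ring.
rewrite etaQ -etabQ.
have eb : 0 <= eta * b by rewrite mulr_ge0// ltW.
have := ler_wpM2l eb epsQ; have := mulr_ge0 eb Q0.
by have := mulr_ge0 eb (mulr_ge0 Q0 k0); lra.
Qed.

End Rates.

(** * Admissible radii, operation counts and the total cost *)

Section CostRates.
Context {R : realType}.
Implicit Types (M eps eta b nu T S Q k : R).

Lemma radius_scale M e (p q : R) : 0 < M -> 0 < p -> 0 < q ->
  e <= 1 / (p * q * M) -> M * e <= 1 / p / q.
Proof.
move=> M0 p0 q0.
rewrite (ler_pdivlMr _ _ (mulr_gt0 (mulr_gt0 p0 q0) M0)).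
rewrite (ler_pdivlMr _ _ q0) (ler_pdivlMr _ _ p0).
by have -> : M * e * q * p = e * (p * q * M) by ring.
Qed.

Lemma eps_radius M eps : 0 < M -> eps <= 1 / (20000 * M) ->
  M * eps <= 1 / 1000 / 20.
Proof.
have -> : 20000 = 1000 * 20 :> R by rewrite -natrM.
have k0 : 0 < 1000 :> R by rewrite ltr0n.
have k1 : 0 < 20 :> R by rewrite ltr0n.
by move=> M0 H; exact: radius_scale M0 k0 k1 H.
Qed.

Lemma eps_radius_le1 (a : R) : a <= 1 / 1000 / 20 -> a <= 1.
Proof. by lra. Qed.

Lemma eta_radius M eta b : 0 < M -> 0 < b -> eta <= 1 / (1000 * b * M) ->
  M * (eta * b) <= 1 / 1000.
Proof.
move=> M0 b0 H; have k0 : 0 < 1000 :> R by rewrite ltr0n.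
have := radius_scale M0 k0 b0 H.
by rewrite (ler_pdivlMr _ _ b0) mulrA.
Qed.

(** Outside the Newton steps a round costs [2 d^2 + 5 d + 4 <= 11 d^2], and each Newton step costs
    at most [4 d^2]. *)
Lemma round_flops_le (d m : nat) : (0 < d)%N -> (0 < m)%N ->
  (round_flops d m <= 11 * m * (d * d))%N.
Proof.
move=> d0; case: m => // m _; rewrite /round_flops /=.
have : (d <= d * d)%N by rewrite leq_pmulr.
have : (0 < d * d)%N by rewrite muln_gt0 d0.
have : (m * d <= m * (d * d))%N by rewrite leq_mul2l leq_pmulr ?orbT.
rewrite mulnDr -!mulnA !(mulnCA m 2); lia.
Qed.

Lemma cost_grad_le (Cg X c2 : R) (d m T : nat) : 0 <= Cg -> (0 < d)%N ->
  (0 < m)%N -> m%:R <= c2 * X ->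
  Cg * (T * m.-1)%:R + (T * round_flops d m)%:R <=
    11 * c2 * ((Cg + d%:R ^+ 2) * T%:R * X).
Proof.
move=> C0 d0 m0 mX.
have f1 : (T * round_flops d m)%:R <= 11 * d%:R ^+ 2 * T%:R * m%:R :> R.
  rewrite -natrX -!natrM ler_nat.
  apply: (leq_trans (leq_mul (leqnn T) (round_flops_le d0 m0))).
  by rewrite expnS expn1; lia.
have f2 : Cg * (T * m.-1)%:R <= 11 * Cg * T%:R * m%:R.
  rewrite natrM; have : (m.-1%:R : R) <= m%:R by rewrite ler_nat leq_pred.
  move=> /(ler_wpM2l (mulr_ge0 C0 (ler0n _ T))).
  by have := mulr_ge0 (mulr_ge0 C0 (ler0n _ T)) (ler0n R m); lra.
have p0 : 0 <= 11 * (Cg + d%:R ^+ 2) * T%:R.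
  by rewrite !mulr_ge0// addr_ge0// sqr_ge0.
by have := ler_wpM2l p0 mX; lra.
Qed.

(** In use, [nu] stands for the square root of the barrier parameter and [A] for the anchor term.
    Multiplying by 41 gives [1 + 82 M Q + 328 M S], and the leading 1, the initial call, is at most
    [2 M S]. *)
Lemma cost_hess_le (h A M nu eps eta b T S Q k : R) : 0 < M -> 0 <= A ->
  1 <= 2 * (M * nu) -> nu <= S -> S <= Q * k -> eta * b * T = Q -> eps * T = S ->
  h / 41 + A <= 1 / 41 + T * (M * (2 * (eta * b) + 8 * eps)) ->
  h <= (82 + 330 * k) * (M * Q).
Proof.
move=> M0 A0 h1 h2 h3 e1 e2.
have -> : T * (M * (2 * (eta * b) + 8 * eps)) = M * (2 * (eta * b * T) + 8 * (eps * T)).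
  by ring.
rewrite e1 e2 => H.
have := ler_wpM2l (ltW M0) h2; have := ler_wpM2l (ltW M0) h3; lra.
Qed.

Lemma cost_total (C1 C2 C3 Cg Ch t h fl D Y MQ : R) : 0 <= C1 -> 0 <= C2 ->
  0 <= C3 -> 0 <= Ch -> 0 <= D * Y -> 0 <= MQ -> h <= C3 * MQ ->
  Cg * t + fl <= C2 * (D * Y) ->
  Cg * t + Ch * h + fl <= (C1 + (C2 + C3)) * (D * Y + Ch * MQ).
Proof.
move=> C10 C20 C30 Ch0 DY Q0 hQ gY.
have := ler_wpM2l Ch0 hQ; have CQ := mulr_ge0 Ch0 Q0.
have := mulr_ge0 C10 DY; have := mulr_ge0 C10 CQ; have := mulr_ge0 C20 CQ.
by have := mulr_ge0 C30 DY; lra.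
Qed.

Lemma alpha_bounds : 0 < (1 / 1000 : R) /\ (1 / 1000 : R) < 1.
Proof.
have k0 : 0 < 1000 :> R by rewrite ltr0n.
by split; [exact: divr_gt0 ltr01 k0 | lra].
Qed.

Lemma alpha_weaken (p q : R) : 0 <= p -> (1 - 1 / 1000) * p <= q ->
  q <= (1 + 1 / 1000) * p -> 99 / 100 * p <= q /\ q <= 101 / 100 * p.
Proof. by move=> p0 l1 l2; split; lra. Qed.

End CostRates.

(** * From the concrete oracles, barrier and losses to the abstract hypotheses *)

Lemma oracle_error (R : realType) (d : nat) (A : 'M[R]_d) (v h : 'cV[R]_d) eps :
  pdef A -> mnorm (invmx A) v <= eps -> `|dotv v h| <= eps * mnorm A h.
Proof.
move=> pA ve; apply: (le_trans (mnorm_dual v h pA)).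
exact: (ler_wpM2r (mnorm_ge0 A h) ve).
Qed.

Lemma hess_oracle_pdef (R : realType) (d : nat) (K : set 'cV[R]_d) f a ohess :
  0 < a -> a < 1 -> is_hess_oracle K f a ohess ->
  forall w, K° w -> pdef (hessian f w).
Proof.
move=> a0 a1 ho w Kw; have := ho 0%N w Kw; case: (ohess 0%N w) => H Hinv /=.
by move=> [HH lo hi _ _]; have [] := loewner_sandwich a0 a1 HH lo hi.
Qed.

Lemma hess_oracle_approx (R : realType) (d : nat) (K : set 'cV[R]_d) f ohess :
  is_hess_oracle K f (1 / 1000) ohess ->
  forall n w, K° w -> hess_approx K° (hessian f) w (ohess n w).1 (ohess n w).2.
Proof.
move=> ho n w Kw; have := ho n w Kw; case: (ohess n w) => H Hinv /= [HH lo hi _ _].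
have [a0 a1] := @alpha_bounds R.
have [pD pH lo' hi'] := loewner_sandwich a0 a1 HH lo hi.
have D0 := (pdef_psd pD).2.
split=> [|||h|h]; [exact: Kw | exact: pH | exact: HH | |].
  exact: (alpha_weaken (D0 h) (lo' h) (hi' h)).1.
exact: (alpha_weaken (D0 h) (lo' h) (hi' h)).2.
Qed.

Lemma barrier_gradient_le (R : realType) (d : nat) (K : set 'cV[R]_d) f (M nu : R) :
  (forall x, K° x -> pdef (hessian f x)) -> sc_barrier K M nu f ->
  forall x h, K° x ->
    `|dotv (gradient f x) h| <= Num.sqrt nu * mnorm (hessian f x) h.
Proof.
move=> pH [_ bnu] x h Kx; apply: (oracle_error h (pH x Kx)).
exact: ler_wsqrtr (bnu x Kx).
Qed.

Lemma subgradient_sum_le (R : realType) (d : nat) (K : set 'cV[R]_d)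
    (l : nat -> 'cV[R]_d -> R) (g w_ : nat -> 'cV[R]_d) (w : 'cV[R]_d) T :
  K w -> (forall t, (1 <= t <= T)%N -> subdifferential K (l t) (w_ t) (g t)) ->
  \sum_(1 <= t < T.+1) (l t (w_ t) - l t w) <=
    \sum_(1 <= t < T.+1) dotv (g t) (w_ t - w).
Proof.
move=> Kw sub; rewrite big_nat_cond [leRHS]big_nat_cond; apply: ler_sum => t.
rewrite andbT ltnS => tT; have := sub t tT w Kw.
by rewrite -opprB dotvNr; lra.
Qed.

(** * Regret and complexity of BARONS *)

Theorem theorem6 (R : realType) :
  (* lower constant of Theta, then its upper constant and an upper limit for c *)
  exists2 c1 : R, 0 < c1 &
  forall c2 c0 : R, c1 <= c2 -> 0 < c0 -> c0 < 1 ->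
  exists2 C : R, 0 < C &
  forall (d : nat) (K : set 'cV[R]_d) (Phi : 'cV[R]_d -> R)
    (M nu b c eta eps alpha : R) (m T : nat) (wstar : 'cV[R]_d)
    (ograd : nat -> 'cV[R]_d -> 'cV[R]_d)
    (ohess : nat -> 'cV[R]_d -> 'M[R]_d * 'M[R]_d)
    (Cgrad Chess : R)
    (l : nat -> 'cV[R]_d -> R) (g : nat -> 'cV[R]_d),
  let w_ := barons_play eta M m wstar ograd ohess g in
  (0 < d)%N ->
  convex_set K -> compact K -> K° !=set0 ->
  0 < M -> sc_barrier K M nu Phi ->
  0 < c -> c <= c0 -> 0 < b ->
  argmin_barrier K Phi wstar ->
  is_grad_oracle K Phi eps ograd ->
  is_hess_oracle K Phi alpha ohess ->
  0 <= Cgrad -> 0 <= Chess ->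
  (1 <= T)%N ->
  (forall t, (1 <= t <= T)%N -> convex_function K (l t)) ->
  (forall t, (1 <= t <= T)%N -> subdifferential K (l t) (w_ t) (g t)) ->
  (forall t, (1 <= t <= T)%N ->
     mnorm (invmx (hessian Phi (w_ t))) (g t) <= b) ->
  0 < eta -> 0 < eps -> (1 <= m)%N ->
  eta = Num.sqrt (nu * ln (1 / c) / (b ^+ 2 * T%:R)) ->
  eps = Num.sqrt (nu / T%:R) ->
  alpha = 1 / 1000 ->
  c1 * ln (1 / (eps * M)) <= m%:R <= c2 * ln (1 / (eps * M)) ->
  eta <= 1 / (1000 * b * M) ->
  eps <= 1 / (20000 * M) ->
  (forall w, shrink K c wstar w ->
     \sum_(1 <= t < T.+1) (l t (w_ t) - l t w)
       <= C * (b * Num.sqrt (nu * T%:R * ln (1 / c)))) /\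
  (nu <= T%:R ->
     barons_cost eta M m wstar ograd ohess g Cgrad Chess T
       <= C * ((Cgrad + d%:R ^+ 2) * T%:R * ln (T%:R / (nu * M))
               + Chess * (M * Num.sqrt (T%:R * nu * ln (1 / c))))).
Proof.
(* The constant 2 is what [third_power_le] asks for in order to get [(1/3)^m <= eps M]. *)
exists 2 => [//|c2 c0 c12 c00 c01].
(* Since [c <= c0], this factor bounds [sqrt (nu T)] by [k Q]. *)
set k := (Num.sqrt (ln (1 / c0)))^-1.
have L00 : 0 < ln (1 / c0) by rewrite ln_gt0// div1r invf_gt1.
have k0 : 0 < k by rewrite invr_gt0 sqrtr_gt0.
have c20 : 0 < c2 by apply: lt_le_trans c12.
have C1 : 0 < 3 + 5 * k by rewrite addr_gt0 ?mulr_gt0 ?ltr0n.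
have C2 : 0 < 11 * c2 by rewrite mulr_gt0 ?ltr0n.
have C3 : 0 < 82 + 330 * k by rewrite addr_gt0 ?mulr_gt0 ?ltr0n.
(* One constant serves both claims: those of the regret, the gradient cost and the Hessian cost are
   added. *)
exists ((3 + 5 * k) + (11 * c2 + (82 + 330 * k))) => [|d K Phi M nu b c eta eps
  alpha m T wstar ograd ohess Cgrad Chess l g w_ d0 cK kK K0 M0 bar c_gt0 cc0 b0
  [Kws wsmin] og oh Cg0 Ch0 T1 _ sub gb eta0 eps0 m0 etaE epsE alphaE /andP[m1 m2]
  eta_le eps_le].
  exact: addr_gt0 C1 (addr_gt0 C2 C3).
rewrite alphaE in oh.
have T0 : 0 < T%:R :> R by rewrite ltr0n.
have nuT : 0 < nu / T%:R by rewrite -sqrtr_gt0 -epsE.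
have nu0 : 0 < nu by rewrite -(divfK (lt0r_neq0 T0) nu) mulr_gt0.
have nuT0 : 0 < nu * T%:R by rewrite mulr_gt0.
have c1 : c < 1 := le_lt_trans cc0 c01.
have L0L : ln (1 / c0) <= ln (1 / c).
  by rewrite ler_ln ?posrE ?divr_gt0// !div1r lef_pV2.
have L0 : 0 < ln (1 / c) := lt_le_trans L00 L0L.
set L := ln (1 / c) in L0 L0L etaE *.
set Q := Num.sqrt (nu * T%:R * L).
have nTL : 0 <= nu * T%:R * L := ltW (mulr_gt0 nuT0 L0).
have etaQ : eta * b * T%:R = Q by rewrite etaE rate_step.
have etabQ : eta * (b * Q) = nu * L.
  have QQ : Q * Q = nu * T%:R * L by rewrite -expr2 sqr_sqrtr.
  apply: (mulIf (lt0r_neq0 T0)).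
  have -> : eta * (b * Q) * T%:R = eta * b * T%:R * Q by ring.
  by rewrite etaQ QQ; ring.
have epsS : eps * T%:R = Num.sqrt (nu * T%:R).
  by rewrite epsE rate_error// ltW.
have SQ : Num.sqrt (nu * T%:R) <= Q * k := sqrt_log_le (ltW nuT0) L00 L0L.
have Q0 : 0 <= Q := sqrtr_ge0 _.
have Meps := eps_radius M0 eps_le.
have Meta := eta_radius M0 b0 eta_le.
have epsM0 : 0 < eps * M := mulr_gt0 eps0 M0.
have epsM1 : eps * M <= 1 by rewrite mulrC; exact: eps_radius_le1.
have m3 := third_power_le epsM0 epsM1 m1.
have X0 : 0 <= ln (1 / (eps * M)) by rewrite ln_ge0// div1r invf_ge1.
have XX : nu <= T%:R -> ln (1 / (eps * M)) <= ln (T%:R / (nu * M)).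
  by move=> nT; exact: ln_rate_le.
have [a0 a1] := @alpha_bounds R.
have pH := hess_oracle_pdef a0 a1 oh.
have scf := bar.1.
have scc := self_concordant_calculus cK M0 scf pH.
have df x (Kx : K° x) := self_concordant_differentiable scf Kx.
have bl := self_concordant_blows_up scf.
have gradP n w h (Kw : K° w) := oracle_error h (pH w Kw) (og n w Kw).
have hessP := hess_oracle_approx oh.
have minP s : exists y, [/\ K° y,
    forall x, K° x -> Phi y + dotv s y <= Phi x + dotv s x
    & forall h, dotv (gradient Phi y + s) h = 0].
  have [y Ky ymin] := barrier_tilt_min s kK bl df Kws.
  by exists y; split; [exact: Ky | exact: ymin | move=> h; exact: tilt_min_gradient h df Ky ymin].
have Gws h : dotv (gradient Phi wstar) h = 0.
  have min0 x (Kx : K° x) : Phi wstar + dotv 0 wstar <= Phi x + dotv 0 x.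
    by rewrite !(dotvC 0) !dotv0r !addr0; exact: wsmin.
  by have := tilt_min_gradient h df Kws min0; rewrite addr0.
have gP t (tT : (1 <= t <= T)%N) (Kt : K° (w_ t)) h :
    `|dotv (g t) h| <= b * mnorm (hessian Phi (w_ t)) h.
  exact: (oracle_error h (pH _ Kt) (gb t tT)).
have wsminU x (Kx : K° x) : Phi wstar <= Phi x := wsmin x Kx.
have b0' := ltW b0; have eta0' := ltW eta0; have eps0' := ltW eps0.
have run := baronsP scc eta0' eps0' b0' Meps Meta m0 m3 gradP hessP minP Kws
  wsminU Gws gP (leqnn T).
split=> [w ws|nT].
  have [_ [x Kx <-] [_ -> wE]] := ws.
  (* A point of the shrunk body sits at time [1 - c] on a segment from [wstar], so the barrier grows
     by at most [nu ln (1/c)]. *)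
  have wE' : w = wstar + (1 - c) *: (x - wstar).
    by rewrite -wE; apply/colP => i; rewrite !mxE; ring.
  have Kray r : 0 <= r < 1 -> K° (wstar + r *: (x - wstar)).
    by exact: interior_segment.
  have c1' : 0 <= 1 - c < 1 by rewrite subr_ge0 (ltW c1) gtrBl c_gt0.
  have Kw : K° w by rewrite wE'; exact: Kray.
  have reg := barons_linear_regret scc eta0' eps0' b0' Meps Meta m0 m3 gradP
    hessP minP Kws wsminU Gws gP Kw.
  have Phw := barrier_growth scc nu0 (barrier_gradient_le pH bar) Kray c1'.
  rewrite -wE' subKr -/L in Phw.
  have reg' := le_trans reg (lerD Phw (lexx _)).
  have epsQ : eps * T%:R <= Q * k by rewrite epsS.
  have rate := regret_rate eta0 b0 Q0 (ltW k0) etaQ etabQ epsQ reg'.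
  have Kw' := interior_subset Kw.
  apply: (le_trans (subgradient_sum_le Kw' sub)); apply: (le_trans rate).
  apply: ler_wpM2r; first exact: mulr_ge0 b0' Q0.
  by rewrite lerDl; exact: (addr_ge0 (ltW C2) (ltW C3)).
rewrite /barons_cost.
case: barons run => st r [_ _ _ hc [-> ->]] /=.
have hess1 : 1 <= 2 * (M * Num.sqrt nu).
  have /ex_strict_bound_gt0[B _ KB] := compact_bounded kK.
  apply: (barrier_parameter_ge scc (barrier_gradient_le pH bar) d0 _ _ Kws Gws).
    by exists B => y /interior_subset Ky; apply/ltW/KB.
  by apply: open_nbhs_nbhs; split; [exact: open_interior | exact: Kws].
have nuS : Num.sqrt nu <= Num.sqrt (nu * T%:R).
  by rewrite ler_wsqrtr// ler_peMr ?(ltW nu0)// ler1n.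
have anchor0 := mulr_ge0 (ltW M0) (mnorm_ge0 (st_H st) (st_w st - st_u st)).
have hh := cost_hess_le M0 anchor0 hess1 nuS SQ etaQ epsS hc.
have mX : m%:R <= c2 * ln (T%:R / (nu * M)).
  by apply: (le_trans m2); rewrite ler_pM2l//; exact: XX.
have gg := cost_grad_le T Cg0 d0 m0 mX.
have Y0 : 0 <= ln (T%:R / (nu * M)) := le_trans X0 (XX nT).
rewrite (mulrC T%:R nu) -/Q.
have MQ := mulr_ge0 (ltW M0) Q0.
have Cd0 : 0 <= Cgrad + d%:R ^+ 2 by rewrite addr_ge0 ?sqr_ge0.
have DY := mulr_ge0 (mulr_ge0 Cd0 (ltW T0)) Y0.
exact: (cost_total (ltW C1) (ltW C2) (ltW C3) Ch0 DY MQ hh gg).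
Qed.
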